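(* Let $M^m$ be an $m$-dimensional manifold ($m\ge 1$) and let $\vec{x}: M^m\to \mathbb{R}^{m+1}$ be an immersed hypersurface, with $M$ carrying the induced metric. Assume that the hypersurface is weakly convex and biharmonic, i.e. its mean curvature vector field $\vec{H}$ satisfies $\Delta \vec{H}=0$ on $M$. Then $\vec{H}=0$ on $M$, i.e. the hypersurface is minimal.
   Context: All manifolds and maps are smooth; $M$ is not assumed compact or complete. The induced metric on $M$ is $g_{ij}=\langle \partial_i\vec{x},\partial_j\vec{x}\rangle$, with Levi-Civita connection $\nabla$; $D$ denotes the flat connection of $\mathbb{R}^{m+1}$. The second fundamental form is the normal-bundle-valued form $h(X,Y)=D_XY-\nabla_XY$ for $X,Y$ tangent to $M$, and the mean curvature vector field is $\vec{H}=\frac1m\sum_{i=1}^m h(e_i,e_i)$, where $\{e_1,\dots,e_m\}$ is a local orthonormal frame of $M$. The operator $\Delta$ is the rough Laplacian on $M$ acting on $\mathbb{R}^{m+1}$-valued vector fields along $\vec{x}$, i.e. up to an overall sign (irrelevant for $\Delta\vec{H}=0$), $\sum_{i=1}^m\big(D_{e_i}D_{e_i}-D_{\nabla_{e_i}e_i}\big)$; equivalently, it is the Laplace–Beltrami operator of $(M,g)$ applied to each Cartesian component. The hypersurface is weakly convex if all its principal curvatures are nonnegative, i.e. there is a unit normal vector field $\nu$ along $M$ such that at every point all eigenvalues of the symmetric bilinear form $(X,Y)\mapsto\langle h(X,Y),\nu\rangle$ with respect to $g$ are nonnegative. *)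

(* Defs.v *)
From mathcomp Require Import all_boot all_order all_algebra.
From mathcomp Require Import all_classical all_reals all_analysis.

Set Implicit Arguments.
Unset Strict Implicit.
Unset Printing Implicit Defensive.

Import Order.TTheory GRing.Theory Num.Theory.
Import numFieldNormedType.Exports.

Local Open Scope classical_set_scope.
Local Open Scope ring_scope.

Section Calculus.
Variable R : realType.

(* The norm of 'rV[R]_n in the library is the sup norm; it is used only for
   the topology. Lengths and angles are always taken with [dot]. *)
Definition dot n (u v : 'rV[R]_n) : R := \sum_(i < n) u 0 i * v 0 i.

Definition partial n (V : normedModType R) (i : 'I_n) (f : 'rV[R]_n -> V) :
    'rV[R]_n -> V :=
  fun u => 'D_(delta_mx 0 i) f u.

(* For open U: all iterated partial derivatives exist and are continuous
   on U, i.e. f is of class C^oo on U. *)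
Definition smooth_on n (V : normedModType R) (U : set 'rV[R]_n)
    (f : 'rV[R]_n -> V) : Prop :=
  forall (s : seq 'I_n) (u : 'rV[R]_n), U u ->
    {for u, continuous (foldr (@partial n V) f s)} /\
    (forall i : 'I_n, derivable (foldr (@partial n V) f s) u (delta_mx 0 i)).

End Calculus.

Section Manifold.
Variable R : realType.

(* [coord] and [param] are total functions, meaningful only on [source] and
   on its image, between which they are mutually inverse homeomorphisms. *)
Record chart (M : topologicalType) (m : nat) := Chart {
  source : set M;
  coord : M -> 'rV[R]_m;
  param : 'rV[R]_m -> M;
  source_open : open source;
  target_open : open (coord @` source);
  coordK : forall p, source p -> param (coord p) = p;
  coord_continuous : {within source, continuous coord};
  param_continuous : {within coord @` source, continuous param} }.

Definition target (M : topologicalType) m (c : chart M m) : set 'rV[R]_m :=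
  coord c @` source c.

Record smooth_manifold (m : nat) := SmoothManifold {
  carrier :> topologicalType;
  manifold_hausdorff : hausdorff_space carrier;
  manifold_second_countable : @second_countable carrier;
  atlas : set (chart carrier m);
  atlas_cover : forall p : carrier, exists2 c, atlas c & source c p;
  atlas_compatible : forall c c', atlas c -> atlas c' ->
    smooth_on (coord c @` (source c `&` source c')) (coord c' \o param c) }.

Definition smooth_map m (M : smooth_manifold m) n (f : M -> 'rV[R]_n) : Prop :=
  forall c, atlas c -> smooth_on (target c) (f \o param c).

Definition immersion m (M : smooth_manifold m) n (f : M -> 'rV[R]_n) : Prop :=
  smooth_map f /\
  (forall c, atlas c -> forall u, target c u ->
     injective ('d (f \o param c) u : 'rV[R]_m -> 'rV[R]_n)).

End Manifold.

(* Geometry of a parametrized piece of hypersurface X : R^m -> R^(m+1), to be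
   used with X = x \o param c. Tangent vector fields are given by their
   components in the coordinates, as functions 'rV[R]_m -> 'rV[R]_m; vector
   fields along X have values in 'rV[R]_m.+1. *)
Section LocalGeometry.
Variables (R : realType) (m : nat) (X : 'rV[R]_m -> 'rV[R]_m.+1).

Definition metric_mx (u : 'rV[R]_m) : 'M[R]_m :=
  \matrix_(i, j) dot (partial i X u) (partial j X u).

Definition metric (u v w : 'rV[R]_m) : R :=
  \sum_(i < m) \sum_(j < m) metric_mx u i j * v 0 i * w 0 j.

Definition christoffel (u : 'rV[R]_m) (k i j : 'I_m) : R :=
  2^-1 * \sum_(l < m) invmx (metric_mx u) k l *
    (partial i (fun w => metric_mx w j l) u
     + partial j (fun w => metric_mx w i l) u
     - partial l (fun w => metric_mx w i j) u).

Definition flat_connection (n : nat) (V : 'rV[R]_m -> 'rV[R]_m)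
    (Z : 'rV[R]_m -> 'rV[R]_n) : 'rV[R]_m -> 'rV[R]_n :=
  fun u => 'D_(V u) Z u.

Definition levi_civita (V W : 'rV[R]_m -> 'rV[R]_m) : 'rV[R]_m -> 'rV[R]_m :=
  fun u => flat_connection V W u +
    \row_k \sum_(i < m) \sum_(j < m) christoffel u k i j * V u 0 i * W u 0 j.

Definition pushforward (W : 'rV[R]_m -> 'rV[R]_m) : 'rV[R]_m -> 'rV[R]_m.+1 :=
  fun u => 'D_(W u) X u.

Definition second_form (V W : 'rV[R]_m -> 'rV[R]_m) : 'rV[R]_m -> 'rV[R]_m.+1 :=
  fun u => flat_connection V (pushforward W) u - pushforward (levi_civita V W) u.

Definition orthonormal_frame (W : set 'rV[R]_m)
    (e : 'I_m -> 'rV[R]_m -> 'rV[R]_m) : Prop :=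
  (forall a, smooth_on W (e a)) /\
  (forall u, W u -> forall a b, metric u (e a u) (e b u) = (a == b)%:R).

Definition frame_mean_curvature (e : 'I_m -> 'rV[R]_m -> 'rV[R]_m)
    : 'rV[R]_m -> 'rV[R]_m.+1 :=
  fun u => m%:R^-1 *: \sum_(a < m) second_form (e a) (e a) u.

Definition rough_laplacian (e : 'I_m -> 'rV[R]_m -> 'rV[R]_m)
    (Z : 'rV[R]_m -> 'rV[R]_m.+1) : 'rV[R]_m -> 'rV[R]_m.+1 :=
  fun u => \sum_(a < m) (flat_connection (e a) (flat_connection (e a) Z) u
                         - flat_connection (levi_civita (e a) (e a)) Z u).

(* k is an eigenvalue, with respect to the metric at u, of the bilinear form
   (v, w) |-> <h(v, w), nu>. As h is tensorial, h(v, w) is computed by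
   extending v and w as fields with constant components. *)
Definition principal_curvature (nu : 'rV[R]_m.+1) (u : 'rV[R]_m) (k : R) : Prop :=
  exists2 v : 'rV[R]_m, v != 0 &
    forall w, dot (second_form (cst v) (cst w) u) nu = k * metric u v w.

End LocalGeometry.

Section Hypersurface.
Variables (R : realType) (m : nat) (M : smooth_manifold R m).
Variable x : M -> 'rV[R]_m.+1.

Definition local_orthonormal_frame (c : chart R M m) (W : set 'rV[R]_m)
    (e : 'I_m -> 'rV[R]_m -> 'rV[R]_m) : Prop :=
  [/\ atlas c, open W, W `<=` target c
    & orthonormal_frame (x \o param c) W e].

(* The mean curvature vector does not depend on the chart or on the frame, so
   this determines H: every point lies in the domain of a local frame. *)
Definition mean_curvature_field (H : M -> 'rV[R]_m.+1) : Prop :=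
  forall c W e, local_orthonormal_frame c W e ->
    forall u, W u ->
      H (param c u) = frame_mean_curvature (x \o param c) e u.

Definition harmonic_field (Z : M -> 'rV[R]_m.+1) : Prop :=
  forall c W e, local_orthonormal_frame c W e ->
    forall u, W u ->
      rough_laplacian (x \o param c) e (Z \o param c) u = 0.

Definition unit_normal_field (nu : M -> 'rV[R]_m.+1) : Prop :=
  [/\ smooth_map nu,
      forall p, dot (nu p) (nu p) = 1
    & forall c, atlas c -> forall u, target c u ->
        forall v, dot (pushforward (x \o param c) (cst v) u) (nu (param c u)) = 0].

Definition weakly_convex : Prop :=
  exists2 nu, unit_normal_field nu &
    forall c, atlas c -> forall u, target c u ->
      forall k, principal_curvature (x \o param c) (nu (param c u)) u k ->
        0 <= k.

End Hypersurface.

(* Main.v *)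
(* In a chart, write X for the immersion, nu for the unit normal, P for the
   inverse metric, b for the second fundamental form and L for the rough
   Laplacian. Then L X = h nu, where h = tr b is m times the mean curvature, so
   that biharmonicity reads L (h nu) = 0. Differentiating L X = h nu and
   <nu, d_l X> = 0 gives <L nu, d_l X> = - d_l h (the traced Codazzi equation),
   so the tangential part of L (h nu) = 0 is h dh + 2 b (grad h, .) = 0.
   As b >= 0, evaluating it on grad h forces dh = 0 wherever h > 0. The set
   h > 0 is open, so L h = 0 there as well, and the normal part of
   L (h nu) = 0 becomes h |d nu|^2 = 0. Hence d nu = 0, thus b = 0 and h = 0 at
   any point where h > 0: since h = tr b >= 0, h vanishes identically. *)
From HB Require Import structures.
Require Import Defs.
From mathcomp Require Import all_boot all_order all_algebra.
From mathcomp Require Import all_classical all_reals all_analysis.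
From mathcomp Require Import ring lra.

Set Implicit Arguments.
Unset Strict Implicit.
Unset Printing Implicit Defensive.

Import Order.TTheory GRing.Theory Num.Theory.
Import numFieldNormedType.Exports.

Local Open Scope classical_set_scope.
Local Open Scope ring_scope.

(** * Smooth functions on an open set *)

(** The argument is pointwise, inside one chart around the given point, with an orthonormal frame on
    the whole chart domain. The frame serves twice: it unfolds the hypotheses on [H], which speak of
    frames, and it gives the inverse metric as the sum over a of e_a^i e_a^j, smooth without matrix
    inversion. All computations use partial derivatives of Cartesian components. The traced Codazzi
    equation needs no covariant derivative of b: it comes from comparing L <d_l X, nu> = 0 with <d_l
    (L X), nu>, where the derivatives of the metric and of X produce the same trace and cancel. Two
    hypotheses need translation. Convexity bounds eigenvalues, whereas b is evaluated on grad h; the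
    Rayleigh quotient links the two. Smoothness of [H], required before L is expanded in
    coordinates, follows from H = h nu / m. Since smoothness means that all iterated partials exist
    and are continuous, stability under operations, linearity of directional derivatives in the
    direction and symmetry of second partials are derived from that definition. *)

Section Lines.
Variables (R : realType) (W : normedModType R).
Implicit Types (f : W -> R) (a v : W).

Lemma is_derive_line f a v t : derivable f (t *: v + a) v ->
  is_derive t 1 (fun s : R => f (s *: v + a)) ('D_v f (t *: v + a)).
Proof.
have E : (fun h : R => h^-1 *: (f ((h *: (1 : R) + t) *: v + a) - f (t *: v + a)))
   = (fun h => h^-1 *: ((f \o shift (t *: v + a)) (h *: v) - f (t *: v + a))).
  by apply/funext => h /=; rewrite scalerDl [h *: 1]mulr1 addrA.
move=> df; split; rewrite /derivable /derive /= E //.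
Qed.

(** The factored form, with s bounded only by |s| <= |t|, covers both signs of t and t = 0 at once;
    the one-variable theorem is applied on [0, t] or [t, 0]. *)
Lemma MVT_line f a v (t : R) :
  (forall s, `|s| <= `|t| -> derivable f (s *: v + a) v) ->
  exists2 s, `|s| <= `|t| &
    f (t *: v + a) - f a = t * 'D_v f (s *: v + a).
Proof.
move=> df; pose p (s : R) := f (s *: v + a).
have p0 : p 0 = f a by rewrite /p scale0r add0r.
have [t0|t0|->] := ltgtP t 0; last first.
- by exists 0 => //; rewrite scale0r add0r subrr mul0r.
- have [||s] := @MVT R p (fun s => 'D_v f (s *: v + a)) 0 t t0.
  + move=> s /[!in_itv]/= /andP[s0 st]; apply: is_derive_line; apply: df.
    by rewrite !gtr0_norm// ltW.
  + apply: derivable_within_continuous => s /[!in_itv]/= /andP[s0 st].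
    have /is_derive_line[//] : derivable f (s *: v + a) v.
    by apply: df; rewrite !ger0_norm// ltW.
  move=> /[!in_itv]/= /andP[s0 st]; rewrite p0 subr0 mulrC => E.
  by exists s => //; rewrite !gtr0_norm// ltW.
- have [||s] := @MVT R p (fun s => 'D_v f (s *: v + a)) t 0 t0.
  + move=> s /[!in_itv]/= /andP[s0 st]; apply: is_derive_line; apply: df.
    by rewrite !ltr0_norm// lerN2 ltW.
  + apply: derivable_within_continuous => s /[!in_itv]/= /andP[s0 st].
    have /is_derive_line[//] : derivable f (s *: v + a) v.
    by apply: df; rewrite !ler0_norm// ?lerN2// ltW.
  move=> /[!in_itv]/= /andP[s0 st]; rewrite p0 sub0r => E.
  exists s; first by rewrite !ltr0_norm// lerN2 ltW.
  by rewrite -[LHS]opprB E; ring.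
Qed.

End Lines.

(** * Closure properties of smooth functions *)

Section Smooth.
Variables (R : realType) (m : nat) (U : set 'rV[R]_m).
Hypothesis oU : open U.
Implicit Types (f g : 'rV[R]_m -> R) (u v : 'rV[R]_m) (i j k : 'I_m).

Lemma nbhs_eq_on (T : Type) (f g : 'rV[R]_m -> T) u : U u ->
  (forall w, U w -> f w = g w) -> nbhs u [set w | f w = g w].
Proof.
move=> Uu fg; have : nbhs u U by exact: open_nbhs_nbhs.
by apply: filterS.
Qed.

Lemma partial_eq_on (V : normedModType R) (f g : 'rV[R]_m -> V) i u : U u ->
  (forall w, U w -> f w = g w) -> partial i f u = partial i g u.
Proof.
by move=> Uu fg; exact: near_eq_derive (nbhs_eq_on Uu fg).
Qed.

Lemma derivable_eq_on (V : normedModType R) (f g : 'rV[R]_m -> V) v u : U u ->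
  (forall w, U w -> f w = g w) -> derivable f u v -> derivable g u v.
Proof.
by move=> Uu fg; exact: near_eq_derivable (nbhs_eq_on Uu fg).
Qed.

Lemma continuous_eq_on (V : normedModType R) (f g : 'rV[R]_m -> V) u : U u ->
  (forall w, U w -> f w = g w) ->
  {for u, continuous f} -> {for u, continuous g}.
Proof.
move=> Uu fg; rewrite /prop_for /continuous_at (fg _ Uu).
move=> cf; apply: cvg_trans cf; exact: near_eq_cvg (nbhs_eq_on Uu fg).
Qed.

Lemma smooth_on_continuous (V : normedModType R) (f : 'rV[R]_m -> V) u :
  smooth_on U f -> U u -> {for u, continuous f}.
Proof. by move=> sf /(sf [::])[]. Qed.

Lemma smooth_on_derivable (V : normedModType R) (f : 'rV[R]_m -> V) i u :
  smooth_on U f -> U u -> derivable f u (delta_mx 0 i).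
Proof. by move=> sf /(sf [::])[]. Qed.

Lemma smooth_on_partial (V : normedModType R) (f : 'rV[R]_m -> V) i :
  smooth_on U f -> smooth_on U (partial i f).
Proof. by move=> sf s u Uu; have := sf (rcons s i) u Uu; rewrite foldr_rcons. Qed.

(** Smoothness quantifies over all words in the partials, so it acts as a greatest fixed point:
    membership in a class stable under partials is enough. Stability is asked only up to equality on
    [U], since values outside [U] are arbitrary. *)
Lemma smooth_on_coind (V : normedModType R) (P : ('rV[R]_m -> V) -> Prop) :
  (forall h, P h -> forall u, U u -> {for u, continuous h}) ->
  (forall h, P h -> forall i u, U u -> derivable h u (delta_mx 0 i)) ->
  (forall h, P h -> forall i,
     exists2 h', P h' & forall u, U u -> partial i h u = h' u) ->
  forall h, P h -> smooth_on U h.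
Proof.
move=> Pc Pd Pp h Ph s.
(* [foldr] applies the last letter first, so the induction peels words from their end; allowing any
   [h0] that agrees with [h] on [U] lets [partial i h0] be traded for a member of [P]. *)
suff: forall h0, (forall u, U u -> h0 u = h u) -> forall u, U u ->
    {for u, continuous (foldr (@partial R m V) h0 s)} /\
    (forall i, derivable (foldr (@partial R m V) h0 s) u (delta_mx 0 i)).
  by apply.
elim/last_ind: s h Ph => [|s i IH] h Ph h0 h0h.
  move=> u Uu /=; split; last move=> i.
    by apply: (@continuous_eq_on _ h) => //; [move=> w /h0h | exact: Pc].
  by apply: (@derivable_eq_on _ h) => //; [move=> w /h0h | exact: Pd].
rewrite foldr_rcons; have [h' Ph' hh'] := Pp _ Ph i.
by apply: IH Ph' _ _ => u Uu; rewrite (partial_eq_on i Uu h0h) hh'.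
Qed.

Lemma smooth_on_eq (V : normedModType R) (f g : 'rV[R]_m -> V) :
  (forall u, U u -> f u = g u) -> smooth_on U f -> smooth_on U g.
Proof.
move=> fg sf; pose P (h : 'rV[R]_m -> V) := exists2 h', smooth_on U h' & forall u, U u -> h' u = h u.
apply: (@smooth_on_coind _ P); last by exists f.
- move=> h [h' sh' hh'] u Uu.
  exact: continuous_eq_on Uu hh' (smooth_on_continuous sh' Uu).
- move=> h [h' sh' hh'] i u Uu.
  exact: derivable_eq_on Uu hh' (smooth_on_derivable sh' Uu).
- move=> h [h' sh' hh'] i; exists (partial i h').
    by exists (partial i h') => //; exact: smooth_on_partial.
  by move=> u Uu; rewrite (partial_eq_on i Uu hh').
Qed.

(** The chain rule is taken in one variable, along the line s |-> s v + u; [L] identifies the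
    difference quotients. *)
Lemma is_derive_sqrt_comp f v u : 0 < f u -> derivable f u v ->
  is_derive u v (fun w => Num.sqrt (f w))
    ((2 * Num.sqrt (f u))^-1 * 'D_v f u).
Proof.
move=> f0 df.
have L (g : 'rV[R]_m -> R) : (fun h : R => h^-1 *: ((g \o shift u) (h *: v) - g u))
   = (fun h : R => h^-1 *: (((fun s => g (s *: v + u)) \o shift 0) (h *: (1 : R))
       - (fun s => g (s *: v + u)) 0)).
  by apply/funext => h /=; rewrite addr0 scale0r add0r [h *: 1]mulr1.
have dp : is_derive (0 : R) (1 : R) (fun s : R => f (s *: v + u)) ('D_v f u).
  by split; [rewrite /derivable -L|rewrite /derive -L].
have ds : is_derive (f (0 *: v + u)) (1 : R) (@Num.sqrt R) (2 * Num.sqrt (f u))^-1.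
  by rewrite scale0r add0r; exact: is_derive1_sqrt.
have [dc Dc] := is_derive1_comp ds dp.
by split; [rewrite /derivable L; exact: dc|rewrite /derive L; exact: Dc].
Qed.

(** Differentiating an inverse or a square root brings in products and inverses, so the operations
    are not stable under partials one at a time. Their joint closure is, and a single coinduction
    settles all cases. Inverses and square roots occur in the Gram-Schmidt process. *)
Inductive smooth_expr : ('rV[R]_m -> R) -> Prop :=
| SmoothGen f : smooth_on U f -> smooth_expr f
| SmoothCst (c : R) : smooth_expr (cst c)
| SmoothAdd f g : smooth_expr f -> smooth_expr g -> smooth_expr (f + g)
| SmoothMul f g : smooth_expr f -> smooth_expr g -> smooth_expr (f * g)
| SmoothInv f : smooth_expr f -> (forall u, U u -> f u != 0) ->
    smooth_expr (fun u => (f u)^-1)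
| SmoothSqrt f : smooth_expr f -> (forall u, U u -> 0 < f u) ->
    smooth_expr (fun u => Num.sqrt (f u)).

Lemma smooth_expr_continuous h : smooth_expr h ->
  forall u, U u -> {for u, continuous h}.
Proof.
elim=> {h} [f sf|c|f g _ IHf _ IHg|f g _ IHf _ IHg|f _ IHf f0|f _ IHf f0] u Uu.
- exact: smooth_on_continuous.
- exact: cst_continuous.
- by apply: continuousD; [exact: IHf|exact: IHg].
- by apply: continuousM; [exact: IHf|exact: IHg].
- by apply: continuousV; [exact: f0|exact: IHf].
- apply: (@continuous_comp _ _ _ f (@Num.sqrt R)); first exact: IHf.
  exact: sqrt_continuous.
Qed.

Lemma smooth_expr_derivable h : smooth_expr h ->
  forall i u, U u -> derivable h u (delta_mx 0 i).
Proof.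
elim=> {h} [f sf|c|f g _ IHf _ IHg|f g _ IHf _ IHg|f _ IHf f0|f _ IHf f0] i u Uu.
- exact: smooth_on_derivable.
- exact: derivable_cst.
- by apply: derivableD; [exact: IHf|exact: IHg].
- by apply: derivableM; [exact: IHf|exact: IHg].
- by apply: derivableV; [exact: f0|exact: IHf].
- by have [] := is_derive_sqrt_comp (f0 _ Uu) (IHf i u Uu).
Qed.

Lemma smooth_expr_partial h : smooth_expr h -> forall i,
  exists2 h', smooth_expr h' & forall u, U u -> partial i h u = h' u.
Proof.
elim=> {h} [f sf|c|f g sf IHf sg IHg|f g sf IHf sg IHg|f sf IHf f0|f sf IHf f0] i.
- by exists (partial i f) => //; apply: SmoothGen; exact: smooth_on_partial.
- exists (cst 0); first exact: SmoothCst.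
  by move=> u _; rewrite /partial derive_cst.
- have [[f' sf' ff'] [g' sg' gg']] := (IHf i, IHg i).
  exists (f' + g'); first exact: SmoothAdd.
  move=> u Uu; rewrite /partial deriveD; last 2 first.
  + exact: smooth_expr_derivable.
  + exact: smooth_expr_derivable.
  by rewrite -[LHS]/(partial i f u + partial i g u) ff'// gg'.
- have [[f' sf' ff'] [g' sg' gg']] := (IHf i, IHg i).
  exists (f * g' + g * f'); first by apply: SmoothAdd; apply: SmoothMul.
  move=> u Uu; rewrite /partial deriveM; last 2 first.
  + exact: smooth_expr_derivable.
  + exact: smooth_expr_derivable.
  by rewrite -[LHS]/(f u * partial i g u + g u * partial i f u) ff'// gg'.
- have [f' sf' ff'] := IHf i.
  pose fV u := (f u)^-1; have sV : smooth_expr fV by exact: SmoothInv.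
  exists (cst (-1) * (fV * fV * f')).
    by repeat (apply: SmoothMul => //); exact: SmoothCst.
  move=> u Uu; rewrite /partial deriveV; last 2 first.
  + exact: f0.
  + exact: smooth_expr_derivable.
  rewrite -[LHS]/(- (f u) ^- 2 * partial i f u) ff'//.
  by rewrite !fctE /fV expr2 invfM; ring.
- have [f' sf' ff'] := IHf i.
  pose fV u := ((cst 2 * (fun w => Num.sqrt (f w))) u)^-1.
  exists (fV * f').
    apply: SmoothMul => //; apply: SmoothInv.
      by apply: SmoothMul; [exact: SmoothCst|exact: SmoothSqrt].
    move=> u Uu; rewrite !fctE mulf_neq0// gt_eqF// sqrtr_gt0; exact: f0.
  move=> u Uu; have [_] := is_derive_sqrt_comp (f0 _ Uu) (smooth_expr_derivable sf (i := i) Uu).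
  rewrite /partial => ->.
  by rewrite -[LHS]/(_ * partial i f u) ff'.
Qed.

Lemma smooth_expr_on h : smooth_expr h -> smooth_on U h.
Proof.
apply: smooth_on_coind.
- exact: smooth_expr_continuous.
- exact: smooth_expr_derivable.
- exact: smooth_expr_partial.
Qed.

#[local] Opaque smooth_on.

Lemma smooth_on_cst (c : R) : smooth_on U (fun=> c).
Proof. exact: smooth_expr_on (SmoothCst c). Qed.

Lemma smooth_onD f g : smooth_on U f -> smooth_on U g ->
  smooth_on U (fun u => f u + g u).
Proof. by move=> sf sg; apply/smooth_expr_on/SmoothAdd; exact: SmoothGen. Qed.

Lemma smooth_onM f g : smooth_on U f -> smooth_on U g ->
  smooth_on U (fun u => f u * g u).
Proof. by move=> sf sg; apply/smooth_expr_on/SmoothMul; exact: SmoothGen. Qed.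

Lemma smooth_onN f : smooth_on U f -> smooth_on U (fun u => - f u).
Proof.
move=> sf; rewrite (_ : (fun u => - f u) = (fun u => -1 * f u)).
  exact: smooth_onM (smooth_on_cst _) sf.
by apply/funext => u; rewrite mulN1r.
Qed.

Lemma smooth_onV f : smooth_on U f -> (forall u, U u -> f u != 0) ->
  smooth_on U (fun u => (f u)^-1).
Proof. by move=> sf f0; apply/smooth_expr_on/SmoothInv => //; exact: SmoothGen. Qed.

Lemma smooth_on_sqrt f : smooth_on U f -> (forall u, U u -> 0 < f u) ->
  smooth_on U (fun u => Num.sqrt (f u)).
Proof. by move=> sf f0; apply/smooth_expr_on/SmoothSqrt => //; exact: SmoothGen. Qed.

Lemma smooth_on_sum (I : Type) (r : seq I) (P : pred I) (F : I -> 'rV[R]_m -> R) :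
  (forall a, P a -> smooth_on U (F a)) ->
  smooth_on U (fun u => \sum_(a <- r | P a) F a u).
Proof.
move=> sF; elim: r => [|a r IH].
  by apply: smooth_on_eq (smooth_on_cst 0) => u _; rewrite big_nil.
case: (boolP (P a)) => Pa.
  apply: smooth_on_eq (smooth_onD (sF a Pa) IH) => u _.
  by rewrite big_cons Pa.
by apply: smooth_on_eq IH => u _; rewrite big_cons (negbTE Pa).
Qed.

Lemma partialD f g i u : smooth_on U f -> smooth_on U g -> U u ->
  partial i (fun w => f w + g w) u = partial i f u + partial i g u.
Proof.
move=> sf sg Uu.
exact: (deriveD (smooth_on_derivable sf Uu) (smooth_on_derivable sg Uu)).
Qed.

Lemma partialM f g i u : smooth_on U f -> smooth_on U g -> U u ->
  partial i (fun w => f w * g w) u = partial i f u * g u + f u * partial i g u.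
Proof.
move=> sf sg Uu; rewrite addrC [partial i f u * _]mulrC.
exact: (deriveM (smooth_on_derivable sf Uu) (smooth_on_derivable sg Uu)).
Qed.

Lemma partial_cst (c : R) i u : partial i (fun=> c) u = 0.
Proof. exact: derive_cst. Qed.

Lemma partial_sum (I : Type) (r : seq I) (P : pred I) (F : I -> 'rV[R]_m -> R) i u :
  (forall a, P a -> smooth_on U (F a)) -> U u ->
  partial i (fun u => \sum_(a <- r | P a) F a u) u =
  \sum_(a <- r | P a) partial i (F a) u.
Proof.
move=> sF Uu; elim: r => [|a r IH].
  rewrite big_nil -[RHS](partial_cst 0 i u); apply: partial_eq_on => // w _.
  by rewrite big_nil.
case: (boolP (P a)) => Pa.
  rewrite big_cons Pa -IH -(partialD _ (sF a Pa) (smooth_on_sum _ sF) Uu).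
  by apply: partial_eq_on => // w _; rewrite big_cons Pa.
rewrite big_cons (negbTE Pa) -IH; apply: partial_eq_on => // w _.
by rewrite big_cons (negbTE Pa).
Qed.

End Smooth.

#[local] Opaque smooth_on.

Lemma continuous_rowP (R : realType) (T : topologicalType) n
    (Z : T -> 'rV[R]_n) (u : T) :
  (forall a, {for u, continuous (fun w => Z w 0 a)}) -> {for u, continuous Z}.
Proof.
move=> cZ; apply/cvgrPdist_le => /= e e0; near=> w.
rewrite /Num.Def.normr/= mx_normrE (bigmax_le _ (ltW e0))//= => -[i j] _.
rewrite !mxE/= (ord1 i); move: j; near: w; apply: filter_forall => /= j.
exact: ((cvgrPdist_le _ _).1 (cZ j) e e0).
Unshelve. all: by end_near. Qed.

Lemma normr_delta_le (R : realType) n (k : 'I_n) (s : R) :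
  `|s *: delta_mx 0 k : 'rV[R]_n| <= `|s|.
Proof.
rewrite normrZ ler_piMr// /Num.Def.normr/= mx_normrE bigmax_le// => -[i j] _ /=.
by rewrite mxE; case: (_ && _); rewrite ?normr1 ?normr0.
Qed.

Lemma coord_le_norm (R : realType) n (v : 'rV[R]_n) (k : 'I_n) : `|v 0 k| <= `|v|.
Proof.
by rewrite [leRHS]/Num.Def.normr/= mx_normrE; exact: (le_bigmax _ _ (0, k)).
Qed.

(** * First-order expansion and symmetry of second partials *)

Section C1.
Variables (R : realType) (m : nat) (U : set 'rV[R]_m).
Hypothesis oU : open U.
Implicit Types (f g : 'rV[R]_m -> R) (u v : 'rV[R]_m) (i j k : 'I_m).

Lemma partial_coord n (Z : 'rV[R]_m -> 'rV[R]_n) i u a : smooth_on U Z -> U u ->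
  partial i Z u 0 a = partial i (fun w => Z w 0 a) u.
Proof.
by move=> sZ Uu; rewrite /partial derive_mx ?mxE//; exact: smooth_on_derivable sZ Uu.
Qed.

Lemma smooth_on_coord n (Z : 'rV[R]_m -> 'rV[R]_n) a :
  smooth_on U Z -> smooth_on U (fun u => Z u 0 a).
Proof.
move=> sZ.
pose P (h : 'rV[R]_m -> R) := exists2 Y : 'rV[R]_m -> 'rV[R]_n,
  smooth_on U Y & h = (fun u => Y u 0 a).
apply: (@smooth_on_coind _ _ _ oU _ P); last by exists Z.
- move=> _ [Y sY ->] u Uu.
  apply: (@continuous_comp _ _ _ Y (fun M : 'rV[R]_n => M 0 a)).
    exact: smooth_on_continuous sY Uu.
  exact: coord_continuous.
- move=> _ [Y sY ->] i u Uu.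
  exact: ((derivable_mxP _ _ _).1 (smooth_on_derivable sY Uu) 0 a).
- move=> _ [Y sY ->] i; exists (fun u => partial i Y u 0 a).
    by exists (partial i Y); first exact: smooth_on_partial.
  by move=> u Uu; rewrite partial_coord.
Qed.

Lemma smooth_on_row n (Z : 'rV[R]_m -> 'rV[R]_n) :
  (forall a, smooth_on U (fun u => Z u 0 a)) -> smooth_on U Z.
Proof.
pose P (Z : 'rV[R]_m -> 'rV[R]_n) := forall a, smooth_on U (fun u => Z u 0 a).
have Pd (h : 'rV[R]_m -> 'rV[R]_n) : P h ->
    forall i u, U u -> derivable h u (delta_mx 0 i).
  move=> Ph i u Uu; apply/derivable_mxP => p a; rewrite (ord1 p).
  exact: smooth_on_derivable (Ph a) Uu.
apply: (@smooth_on_coind _ _ _ oU _ P); [|exact: Pd|].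
- move=> h Ph u Uu; apply: continuous_rowP => a.
  exact: smooth_on_continuous (Ph a) Uu.
- move=> h Ph i; exists (partial i h); last by [].
  move=> a; apply: (smooth_on_eq oU _ (smooth_on_partial i (Ph a))) => u Uu.
  rewrite /partial derive_mx ?mxE; first by [].
  exact: Pd.
Qed.

Lemma near_radius u (P : 'rV[R]_m -> Prop) : (\forall w \near u, P w) ->
  exists2 r : R, 0 < r & forall h : 'rV[R]_m, `|h| < r -> P (h + u).
Proof.
move=> /nbhs_ballP[r /= r0 br]; exists r => // h hr; apply: br.
by rewrite -ball_normE/= opprD addrCA subrr addr0 normrN.
Qed.

Lemma near_open u : U u -> \forall w \near u, U w.
Proof. by move=> Uu; exact: open_nbhs_nbhs. Qed.

Lemma near_close f u (e : R) : smooth_on U f -> U u -> 0 < e ->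
  \forall w \near u, `|f u - f w| <= e.
Proof.
by move=> sf Uu e0; exact: ((cvgrPdist_le _ _).1 (smooth_on_continuous sf Uu) e e0).
Qed.

(** Corners of a staircase from 0 to h that switches on one coordinate at a time: each edge is
    parallel to an axis, where the one-variable mean value theorem applies. *)
Let trunc (h : 'rV[R]_m) (n : nat) : 'rV[R]_m :=
  \row_i (if (i < n)%N then h 0 i else 0).

Let truncS (h : 'rV[R]_m) k : trunc h k.+1 = h 0 k *: delta_mx 0 k + trunc h k.
Proof.
apply/rowP => i; rewrite !mxE eqxx/= ltnS leq_eqVlt.
case: (eqVneq i k) => [->|ik]; first by rewrite eqxx ltnn mulr1 addr0.
have -> : (i == k :> nat) = false by exact: negbTE ik.
by rewrite mulr0 add0r.
Qed.

(** As the norm is the sup norm, the edges of the staircase, and not only its corners, stay within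
    distance |h|. *)
Let norm_trunc (h : 'rV[R]_m) k (s : R) : `|s| <= `|h 0 k| ->
  `|s *: delta_mx 0 k + trunc h k| <= `|h|.
Proof.
move=> sh; rewrite [leLHS]/Num.Def.normr/= mx_normrE bigmax_le// => -[p i] _ /=.
rewrite (ord1 p) !mxE eqxx/=.
case: (eqVneq i k) => [->|ik].
  by rewrite ltnn mulr1 addr0 (le_trans sh)// coord_le_norm.
rewrite mulr0 add0r; case: ifP => _; first exact: coord_le_norm.
by rewrite normr0.
Qed.

(** The increments along the staircase telescope; on each edge the mean value theorem gives a
    partial at a nearby point, close to the partial at u by continuity. *)
Lemma smooth_on_C1_bound f u (e : R) : smooth_on U f -> U u -> 0 < e ->
  exists2 r : R, 0 < r & forall h : 'rV[R]_m, `|h| < r ->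
    `|f (h + u) - f u - \sum_i h 0 i * partial i f u| <= e * `|h|.
Proof.
(* Each of the m edges costs at most d |h|; dividing by m + 1 instead of m also covers m = 0. *)
move=> sf Uu e0; pose d := e / m.+1%:R.
have d0 : 0 < d by rewrite divr_gt0// ltr0n.
have [r r0 rP] : exists2 r : R, 0 < r & forall h : 'rV[R]_m, `|h| < r ->
    U (h + u) /\ forall k, `|partial k f u - partial k f (h + u)| <= d.
  apply: (@near_radius u
    (fun w => U w /\ forall k, `|partial k f u - partial k f w| <= d)).
  near=> w; split; near: w; first exact: near_open.
  apply: filter_forall => k.
  exact: near_close (smooth_on_partial k sf) Uu d0.
exists r => // h hr.
have -> : f (h + u) - f u = \sum_(k < m) (f (trunc h k.+1 + u) - f (trunc h k + u)).
  rewrite -(big_mkord xpredT (fun k : nat => f (trunc h k.+1 + u) - f (trunc h k + u))).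
  rewrite (telescope_sumr (fun k : nat => f (trunc h k + u)))//; congr (f (_ + _) - f _).
    by apply/rowP => i; rewrite mxE ltn_ord.
  by apply/rowP => i; rewrite !mxE ltn0 add0r.
rewrite -sumrB (le_trans (ler_norm_sum _ _ _))//.
apply: (@le_trans _ _ (\sum_(k < m) d * `|h|)).
  apply: ler_sum => k _; rewrite truncS -(addrA (_ *: _)).
  have [|s sh ->] := @MVT_line R _ f (trunc h k + u) (delta_mx 0 k) (h 0 k).
    move=> s sh; apply: smooth_on_derivable sf _; rewrite addrA.
    by have [] := rP _ (le_lt_trans (norm_trunc sh) hr).
  rewrite -[X in _ - X]/(h 0 k * partial k f u) -mulrBr normrM mulrC.
  apply: ler_pM => //; last exact: coord_le_norm.
  rewrite distrC addrA.
  by have [_] := rP _ (le_lt_trans (norm_trunc sh) hr); exact.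
rewrite sumr_const card_ord -mulrnAl; apply: ler_wpM2r => //.
rewrite -mulr_natr /d -mulrA ger_pMr// mulrC ler_pdivrMr ?ltr0n// mul1r.
by rewrite ler_nat.
Unshelve. all: by end_near. Qed.

Let dmap f u (v : 'rV[R]_m) : R := \sum_i v 0 i * partial i f u.

Let dmap_linear f u : linear (dmap f u).
Proof.
move=> c v w; rewrite /dmap scaler_sumr -big_split; apply: eq_bigr => i _ /=.
by rewrite !mxE mulrDl -[LHS]/(c * v 0 i * _ + _) -mulrA.
Qed.

HB.instance Definition _ f u :=
  GRing.isLinear.Build R 'rV[R]_m R _ (dmap f u) (@dmap_linear f u).

(** The bound of [smooth_on_C1_bound] is the little-o condition for the candidate [dmap f u], which
    uniqueness of the differential then identifies with ['d f u]. *)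
Lemma smooth_on_is_diff f u : smooth_on U f -> U u ->
  differentiable f u /\ forall v, 'd f u v = \sum_i v 0 i * partial i f u.
Proof.
move=> sf Uu.
have dc : continuous (dmap f u).
  have dr (r : seq 'I_m) :
      continuous (fun v : 'rV[R]_m => \sum_(i <- r) v 0 i * partial i f u).
    elim: r => [|i r IH].
      by under eq_fun do rewrite big_nil; exact: cst_continuous.
    under eq_fun do rewrite big_cons; move=> w.
    have ci : {for w, continuous (fun v : 'rV[R]_m => v 0 i)}.
      exact: coord_continuous.
    have cp : {for w, continuous (fun v : 'rV[R]_m => partial i f u)}.
      exact: cst_continuous.
    exact: (continuousD (continuousM ci cp) (IH w)).
  exact: dr.
have C1 (e : R) : 0 < e -> \forall h \near (0 : 'rV[R]_m),
    `|f (h + u) - (f u + dmap f u h)| <= e * `|h|.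
  move=> e0; have [r r0 rP] := smooth_on_C1_bound sf Uu e0.
  apply/nbhs_ballP; exists r => //= h; rewrite -ball_normE/= sub0r normrN.
  by rewrite opprD addrA; exact: rP.
have D : 'd f u = dmap f u :> ('rV[R]_m -> R).
  by apply: (diff_unique dc); apply/eqaddoP => e e0; exact: C1.
split; last by move=> v; rewrite D.
apply/diff_locallyP; rewrite D; split; first exact: dc.
by apply/eqaddoP => e e0; exact: C1.
Qed.

(** The connections are defined by directional derivatives, whose linearity in the direction is not
    automatic; it comes from differentiability. *)
Lemma derive_partial f u v : smooth_on U f -> U u ->
  'D_v f u = \sum_i v 0 i * partial i f u.
Proof.
by move=> sf Uu; have [df <-] := smooth_on_is_diff sf Uu; rewrite deriveE.
Qed.

Lemma smooth_on_differentiable_row n (Z : 'rV[R]_m -> 'rV[R]_n) u :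
  smooth_on U Z -> U u -> differentiable Z u.
Proof.
move=> sZ Uu.
rewrite (_ : Z = \sum_(a < n) (fun w => Z w 0 a *: (delta_mx 0 a : 'rV[R]_n))).
  apply: differentiable_sum => a; apply: differentiableZl.
  by have [] := smooth_on_is_diff (smooth_on_coord a sZ) Uu.
apply/funext => w; rewrite fct_sumE; exact: row_sum_delta.
Qed.

Lemma derive_row_partial n (Z : 'rV[R]_m -> 'rV[R]_n) u v a :
  smooth_on U Z -> U u ->
  ('D_v Z u) 0 a = \sum_i v 0 i * partial i (fun w => Z w 0 a) u.
Proof.
move=> sZ Uu.
rewrite derive_mx; last exact: diff_derivable (smooth_on_differentiable_row sZ Uu).
by rewrite mxE (derive_partial v (smooth_on_coord a sZ) Uu).
Qed.

Lemma is_derive_translate f u v w : derivable f (w + u) v ->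
  is_derive u v (fun y => f (w + y)) ('D_v f (w + u)).
Proof.
have E : (fun h : R => h^-1 *: (((fun y => f (w + y)) \o shift u) (h *: v) - f (w + u)))
    = (fun h : R => h^-1 *: ((f \o shift (w + u)) (h *: v) - f (w + u))).
  by apply/funext => h /=; rewrite addrCA.
by move=> df; split; [rewrite /derivable E|rewrite /derive E].
Qed.

(** The mean value theorem is applied along e_i to the difference [g] of f in the direction e_j,
    then along e_j to d_i f. The left-hand side is symmetric in i and j, the right-hand side is not
    visibly so. *)
Lemma mixed_difference f u i j (t r : R) : smooth_on U f -> `|t| + `|t| < r ->
  (forall h : 'rV[R]_m, `|h| < r -> U (h + u)) ->
  exists2 h : 'rV[R]_m, `|h| <= `|t| + `|t| &
    f (t *: delta_mx 0 j + (t *: delta_mx 0 i + u)) - f (t *: delta_mx 0 i + u)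
    - (f (t *: delta_mx 0 j + u) - f u)
    = t * (t * partial j (partial i f) (h + u)).
Proof.
move=> sf tr rU.
pose ei : 'rV[R]_m := delta_mx 0 i; pose ej : 'rV[R]_m := delta_mx 0 j.
have Ub (a b : R) : `|a| <= `|t| -> `|b| <= `|t| -> U (b *: ej + (a *: ei + u)).
  move=> at' bt; rewrite addrA; apply: rU; apply: le_lt_trans tr.
  by apply: (le_trans (ler_normD _ _)); apply: lerD;
    apply: le_trans (normr_delta_le _ _) _.
have U0 (a : R) : `|a| <= `|t| -> U (a *: ei + u).
  by move=> at'; have := Ub a 0 at'; rewrite scale0r add0r normr0; exact.
pose g w := f (t *: ej + w) - f w.
have dg (a : R) : `|a| <= `|t| -> is_derive (a *: ei + u) ei g
    (partial i f (t *: ej + (a *: ei + u)) - partial i f (a *: ei + u)).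
  move=> at'; apply: is_deriveB.
    by apply: is_derive_translate; apply: smooth_on_derivable sf _; exact: Ub.
  by apply: derivableP; apply: smooth_on_derivable sf _; exact: U0.
have [a at' gE] := @MVT_line R _ g u ei t (fun a ha => @ex_derive _ _ _ _ _ _ _ (dg a ha)).
have [b bt fE] := @MVT_line R _ (partial i f) (a *: ei + u) ej t
  (fun b hb => smooth_on_derivable (smooth_on_partial i sf) (Ub a b at' hb)).
exists (b *: ej + a *: ei).
  by apply: (le_trans (ler_normD _ _)); apply: lerD;
    apply: le_trans (normr_delta_le _ _) _.
rewrite -[LHS]/(g (t *: ei + u) - g u) gE (@derive_val _ _ _ _ _ _ _ (dg a at')).
by rewrite fE addrA.
Qed.

(** By the symmetry of the second difference, d_i d_j f at one point near u equals d_j d_i f at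
    another; continuity of both at u concludes. *)
Lemma partialC f u i j : smooth_on U f -> U u ->
  partial i (partial j f) u = partial j (partial i f) u.
Proof.
move=> sf Uu; apply/eqP; rewrite -subr_eq0 -normr_le0; apply/ler_addgt0Pr => e e0.
rewrite add0r.
have e2 : 0 < e / 2 by rewrite divr_gt0.
have sij k l : smooth_on U (partial k (partial l f)).
  exact: smooth_on_partial (smooth_on_partial _ sf).
have [r r0 rP] : exists2 r : R, 0 < r & forall h : 'rV[R]_m, `|h| < r ->
    [/\ U (h + u),
     `|partial i (partial j f) u - partial i (partial j f) (h + u)| <= e / 2 &
     `|partial j (partial i f) u - partial j (partial i f) (h + u)| <= e / 2].
  apply: (@near_radius u (fun w => [/\ U w,
     `|partial i (partial j f) u - partial i (partial j f) w| <= e / 2 &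
     `|partial j (partial i f) u - partial j (partial i f) w| <= e / 2])).
  have cij := near_close (sij i j) Uu e2.
  have cji := near_close (sij j i) Uu e2.
  have oUu := near_open Uu.
  move: oUu cij cji; apply: filterS3 => w; exact: And3.
(* The intermediate points are within 2 |t| = r / 2 of u, inside the radius where both mixed
   partials vary by at most e / 2. *)
pose t := r / 4.
have t0 : 0 < t by rewrite divr_gt0.
have tr : `|t| + `|t| < r by rewrite gtr0_norm// /t; lra.
have rU (h : 'rV[R]_m) : `|h| < r -> U (h + u) by case/rP.
have [h1 /le_lt_trans/(_ tr)/rP[_ _ h1e] E1] := mixed_difference i j sf tr rU.
have [h2 /le_lt_trans/(_ tr)/rP[_ h2e _] E2] := mixed_difference j i sf tr rU.
have comb (a b A B D1 D2 : R) : `|a - A| <= e / 2 -> `|b - B| <= e / 2 ->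
    D1 = t * (t * B) -> D2 = t * (t * A) -> D1 = D2 -> `|a - b| <= e.
  move=> aA bB -> -> E; have tn0 : t != 0 by rewrite gt_eqF.
  have {}E : B = A by apply: (mulfI tn0); exact: (mulfI tn0).
  rewrite (splitr e) -(subrKA A); apply: (le_trans (ler_normD _ _)).
  by apply: lerD; rewrite // -E distrC.
apply: (comb _ _ _ _ _ _ h2e h1e E1 E2).
by rewrite addrCA; ring.
Qed.

End C1.

(** * Linear algebra *)

Section Bilinear.
Variables (R : realType) (m : nat).
Implicit Types (A P : 'M[R]_m) (v w : 'rV[R]_m).

Definition bilin A v w : R := (v *m A *m w^T) 0 0.

Lemma bilinE A v w : bilin A v w = \sum_i \sum_j A i j * v 0 i * w 0 j.
Proof.
rewrite /bilin mxE exchange_big; apply: eq_bigr => j _.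
rewrite !mxE mulr_suml; apply: eq_bigr => i _.
by rewrite [v 0 i * _]mulrC.
Qed.

Lemma bilinDl A v1 v2 w : bilin A (v1 + v2) w = bilin A v1 w + bilin A v2 w.
Proof. by rewrite /bilin !mulmxDl mxE. Qed.

Lemma bilinZl A c v w : bilin A (c *: v) w = c * bilin A v w.
Proof. by rewrite /bilin -!scalemxAl mxE. Qed.

Lemma bilinC A v w : A^T = A -> bilin A v w = bilin A w v.
Proof.
move=> As; rewrite /bilin.
have -> : v *m A *m w^T = (w *m A *m v^T)^T by rewrite !trmx_mul trmxK As mulmxA.
by rewrite mxE.
Qed.

Lemma bilinDr A v w1 w2 : bilin A v (w1 + w2) = bilin A v w1 + bilin A v w2.
Proof. by rewrite /bilin linearD mulmxDr mxE. Qed.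

Lemma bilinZr A c v w : bilin A v (c *: w) = c * bilin A v w.
Proof. by rewrite /bilin linearZ -scalemxAr mxE. Qed.

Lemma bilin_mxB A B (k : R) v w :
  bilin (A - k *: B) v w = bilin A v w - k * bilin B v w.
Proof. by rewrite /bilin mulmxBr mulmxBl -scalemxAr -scalemxAl !mxE. Qed.

Lemma bilin_sumr A v (I : Type) (r : seq I) (Q : pred I) (F : I -> 'rV[R]_m) :
  bilin A v (\sum_(a <- r | Q a) F a) = \sum_(a <- r | Q a) bilin A v (F a).
Proof. by rewrite /bilin linear_sum mulmx_sumr summxE. Qed.

Lemma bilin0l A w : bilin A 0 w = 0.
Proof. by rewrite /bilin !mul0mx mxE. Qed.

(** [v0] minimizes the quadratic form, so the first variation in the direction w vanishes. *)
Lemma bilin_isotropic A v0 w : A^T = A -> (forall v, 0 <= bilin A v v) ->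
  bilin A v0 v0 = 0 -> bilin A v0 w = 0.
Proof.
move=> As A0 v00; apply/eqP; apply: contraT => c0.
set c := bilin A v0 w in c0; set d := bilin A w w.
have d0 : 0 <= d by exact: A0.
(* The optimal step would be - c / d, but d may be 0. The value at this t is -c^2 (d + 2) / (d +
   1)^2, negative unless c = 0. *)
pose t := - c / (d + 1).
have := A0 (v0 + t *: w).
rewrite !(bilinDl, bilinDr, bilinZl, bilinZr) v00 (bilinC w v0 As) -/c -/d.
have -> : 0 + t * c + (t * c + t * (t * d)) = - (c ^+ 2 * (d + 2)) / (d + 1) ^+ 2.
  by rewrite /t; field; rewrite gt_eqF//; lra.
rewrite pmulr_lge0 ?invr_gt0 ?exprn_gt0//; last lra.
rewrite oppr_ge0 pmulr_lle0; last lra.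
by rewrite leNgt exprn_even_gt0//= c0.
Qed.

Lemma continuous_bilin A : continuous (fun v : 'rV[R]_m => bilin A v v).
Proof.
move=> v; apply: differentiable_continuous.
rewrite (_ : (fun v => _) = \sum_(i < m) \sum_(j < m)
    (fun v : 'rV[R]_m => A i j * v 0 i * v 0 j)).
  apply: differentiable_sum => i; apply: differentiable_sum => j.
  apply: differentiableM; last exact: differentiable_coord.
  apply: differentiableM; first exact: differentiable_cst.
  exact: differentiable_coord.
apply/funext => w; rewrite bilinE fct_sumE; apply: eq_bigr => i _.
by rewrite fct_sumE.
Qed.

(* The minimum of the Rayleigh quotient is an eigenvalue. *)
Lemma bilin_ge0_eigen A G v : A^T = A -> G^T = G ->
  (forall w, w != 0 -> 0 < bilin G w w) ->
  (forall k w, w != 0 -> (forall w', bilin A w w' = k * bilin G w w') -> 0 <= k) ->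
  0 <= bilin A v v.
Proof.
move=> As Gs G0 eigen_ge0; have [->|v0] := eqVneq v 0; first by rewrite bilin0l.
(* The sup-norm sphere does as well as a Euclidean one: [phi] below is invariant under scaling, so
   its minimum on [S] is its minimum over all nonzero vectors. *)
pose S := [set w : 'rV[R]_m | `|w| = 1].
have Sne w : S w -> w != 0 by move=> w1; rewrite -normr_eq0 w1 oner_eq0.
have cS : compact S.
  apply: bounded_closed_compact.
    by exists 1; split => // x x1 w /= ->; exact: ltW.
  rewrite (_ : S = (fun w : 'rV[R]_m => `|w|) @^-1` [set 1]) //.
  by apply: closed_comp => //; move=> w _; exact: norm_continuous.
pose phi w := bilin A w w / bilin G w w.
have phiZ (c : R) w : c != 0 -> phi (c *: w) = phi w.
  move=> c0; rewrite /phi !(bilinZl, bilinZr) !mulrA -!expr2.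
  by rewrite -mulf_div divff ?mul1r// expf_neq0.
have S0 w : w != 0 -> S (`|w|^-1 *: w).
  by move=> w0; rewrite /S /= normrZ normfV normr_id mulVf// normr_eq0.
have cphi : {within S, continuous phi}.
  rewrite continuous_subspace_in => w /set_mem Sw; have w0 := Sne _ Sw.
  have cw : {for w, continuous phi}.
    have G0w : bilin G w w != 0 by rewrite gt_eqF// G0.
    have cA : {for w, continuous (fun v => bilin A v v)}.
      exact: continuous_bilin.
    have cG : {for w, continuous (fun v => bilin G v v)}.
      exact: continuous_bilin.
    have cV : {for w, continuous (fun v => (bilin G v v)^-1)} by exact: continuousV.
    exact: (continuousM cA cV).
  exact: (continuous_subspaceT_for Sw cw).
have [w /set_mem wS wmin] : exists2 c, c \in S & forall t, t \in S -> phi c <= phi t.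
  by apply: EVT_min_rV => //; exists (`|v|^-1 *: v); exact: S0.
have w0 := Sne _ wS.
have phi_min w' : w' != 0 -> phi w <= phi w'.
  move=> w'0; rewrite -(phiZ `|w'|^-1 w') ?invr_eq0 ?normr_eq0//.
  by apply: wmin; apply/mem_set; exact: S0.
(* [Q] is nonnegative by minimality and vanishes at w, so w lies in its kernel: it is an eigenvector
   with eigenvalue [phi w]. *)
pose Q := A - phi w *: G.
have Qs : Q^T = Q by rewrite /Q linearB linearZ /= As Gs.
have Q0 w' : 0 <= bilin Q w' w'.
  have [->|w'0] := eqVneq w' 0; first by rewrite bilin0l.
  by rewrite bilin_mxB subr_ge0 -ler_pdivlMr ?G0// phi_min.
have Qw : bilin Q w w = 0.
  by rewrite bilin_mxB /phi divfK ?subrr// gt_eqF// G0.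
have k0 : 0 <= phi w.
  apply: (eigen_ge0 _ w w0) => w'; apply/eqP; rewrite -subr_eq0 -bilin_mxB.
  by rewrite (bilin_isotropic w' Qs Q0 Qw).
have := phi_min _ v0 => /(le_trans k0).
by rewrite /phi pmulr_lge0// invr_gt0 G0.
Qed.

End Bilinear.

Section NormalFrame.
Variables (R : realType) (m : nat).
Variables (J : 'M[R]_(m, m.+1)) (n : 'rV[R]_m.+1) (P : 'M[R]_m).
Hypotheses (PJ : P *m (J *m J^T) = 1%:M) (Jn : J *m n^T = 0) (nn : n *m n^T = 1%:M).

(** Stacking n on J gives a square matrix [C] with right inverse [D]; a right inverse of a square
    matrix is also a left inverse, and D C = 1 is the claim. *)
Lemma normal_frame_complete : J^T *m P *m J + n^T *m n = 1%:M.
Proof.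
have JP : J *m (J^T *m P) = 1%:M by rewrite mulmxA; exact: mulmx1C.
have nJ : n *m J^T = 0 by rewrite -[LHS]trmxK trmx_mul trmxK Jn trmx0.
pose C : 'M[R]_(1 + m, m.+1) := col_mx n J.
pose D : 'M[R]_(m.+1, 1 + m) := row_mx n^T (J^T *m P).
have CD : C *m D = 1%:M.
  rewrite mul_col_row nn Jn JP mulmxA nJ mul0mx.
  by rewrite -scalar_mx_block.
have := mulmx1C CD; rewrite mul_row_col addrC => <-.
by [].
Qed.

(** Each row of W splits into a tangential part, with coefficients W J^T P in the basis J, and a
    normal part along n. *)
Lemma normal_frame_decomp k (W : 'M[R]_(k, m.+1)) :
  W = W *m J^T *m P *m J + W *m n^T *m n.
Proof. by rewrite -[LHS]mulmx1 -normal_frame_complete mulmxDr !mulmxA. Qed.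

End NormalFrame.

(** * The Laplacian in coordinates *)

(* Locked, so that unification never unfolds it down to limits. *)
HB.lock Definition pd (R : realType) (m : nat) (i : 'I_m) (f : 'rV[R]_m -> R) :=
  partial i f.

Section LockedPartial.
Variables (R : realType) (m : nat) (U : set 'rV[R]_m).
Hypothesis oU : open U.
Implicit Types (f g : 'rV[R]_m -> R) (u v : 'rV[R]_m) (i j k : 'I_m).

Lemma pdE f i : pd i f = partial i f.
Proof. by rewrite pd.unlock. Qed.

Lemma smooth_pd i f : smooth_on U f -> smooth_on U (pd i f).
Proof. by rewrite pd.unlock; exact: smooth_on_partial. Qed.

Lemma pd_eq_on f g i u : U u -> (forall w, U w -> f w = g w) -> pd i f u = pd i g u.
Proof. by rewrite pd.unlock; exact: partial_eq_on. Qed.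

Lemma pdD f g i u : smooth_on U f -> smooth_on U g -> U u ->
  pd i (fun w => f w + g w) u = pd i f u + pd i g u.
Proof. by rewrite pd.unlock; exact: partialD. Qed.

Lemma pdM f g i u : smooth_on U f -> smooth_on U g -> U u ->
  pd i (fun w => f w * g w) u = pd i f u * g u + f u * pd i g u.
Proof. by rewrite pd.unlock; exact: partialM. Qed.

Lemma pd_cst (c : R) i u : pd i (fun=> c) u = 0.
Proof. by rewrite pd.unlock; exact: partial_cst. Qed.

Lemma pd_sum (I : Type) (r : seq I) (P : pred I) (F : I -> 'rV[R]_m -> R) i u :
  (forall a, P a -> smooth_on U (F a)) -> U u ->
  pd i (fun u => \sum_(a <- r | P a) F a u) u = \sum_(a <- r | P a) pd i (F a) u.
Proof. by rewrite pd.unlock; exact: partial_sum. Qed.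

Lemma pdC f u i j : smooth_on U f -> U u -> pd i (pd j f) u = pd j (pd i f) u.
Proof. by rewrite pd.unlock; exact: partialC. Qed.

Lemma pd_coord n (Z : 'rV[R]_m -> 'rV[R]_n) i u a : smooth_on U Z -> U u ->
  partial i Z u 0 a = pd i (fun w => Z w 0 a) u.
Proof. by rewrite pd.unlock; exact: partial_coord. Qed.

Lemma derive_row_pd n (Z : 'rV[R]_m -> 'rV[R]_n) u v a :
  smooth_on U Z -> U u ->
  ('D_v Z u) 0 a = \sum_i v 0 i * pd i (fun w => Z w 0 a) u.
Proof. by rewrite pd.unlock; exact: derive_row_partial. Qed.

End LockedPartial.

Section LocalHypersurface.
Variables (R : realType) (m : nat) (U : set 'rV[R]_m).
Variables (X : 'rV[R]_m -> 'rV[R]_m.+1) (e : 'I_m -> 'rV[R]_m -> 'rV[R]_m).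
Hypotheses (oU : open U) (sX : smooth_on U X) (frame_e : orthonormal_frame X U e).
Implicit Types (f g : 'rV[R]_m -> R) (u v : 'rV[R]_m) (i j k l : 'I_m).

Let x (c : 'I_m.+1) u : R := X u 0 c.

Definition jacobian_mx u : 'M[R]_(m, m.+1) := \matrix_(i, c) pd i (x c) u.

Definition frame_mx u : 'M[R]_m := \matrix_(a, i) e a u 0 i.

(** The inverse metric (see [cometric_mxK]), in a form that inherits its smoothness from the
    frame. *)
Definition cometric i j u : R := \sum_a e a u 0 i * e a u 0 j.

Definition cometric_mx u : 'M[R]_m := \matrix_(i, j) cometric i j u.

(** Christoffel symbols of the first kind: for an induced metric they are <d_i d_j X, d_l X>. *)
Definition hess_grad i j l u : R :=
  \sum_c pd i (pd j (x c)) u * pd l (x c) u.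

Definition gamma k i j u : R := \sum_l cometric k l u * hess_grad i j l u.

(** Minus the metric trace of the Christoffel symbols, the first-order coefficient of the
    Laplace-Beltrami operator. *)
Definition drift k u : R := - \sum_i \sum_j cometric i j u * gamma k i j u.

Definition laplacian f u : R :=
  \sum_i \sum_j cometric i j u * pd i (pd j f) u
  + \sum_k drift k u * pd k f u.

Lemma smooth_x c : smooth_on U (x c).
Proof. exact: smooth_on_coord. Qed.

Lemma smooth_dx i c : smooth_on U (pd i (x c)).
Proof. exact (smooth_pd i (smooth_x c)). Qed.

Lemma smooth_ddx i j c : smooth_on U (pd i (pd j (x c))).
Proof. exact (smooth_pd i (smooth_dx j c)). Qed.

Lemma smooth_frame a i : smooth_on U (fun u => e a u 0 i).
Proof. by case: frame_e => se _; exact: (smooth_on_coord oU i (se a)). Qed.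

Lemma smooth_cometric i j : smooth_on U (cometric i j).
Proof.
apply: (smooth_on_sum oU) => a _.
exact: (smooth_onM oU (smooth_frame a i) (smooth_frame a j)).
Qed.

Lemma smooth_hess_grad i j l : smooth_on U (hess_grad i j l).
Proof.
apply: (smooth_on_sum oU) => c _.
exact: (smooth_onM oU (smooth_ddx i j c) (smooth_dx l c)).
Qed.

Lemma smooth_gamma k i j : smooth_on U (gamma k i j).
Proof.
apply: (smooth_on_sum oU) => l _.
exact: (smooth_onM oU (smooth_cometric k l) (smooth_hess_grad i j l)).
Qed.

Lemma smooth_drift k : smooth_on U (drift k).
Proof.
apply: (smooth_onN oU).
apply: (smooth_on_sum oU) => i _; apply: (smooth_on_sum oU) => j _.
exact: (smooth_onM oU (smooth_cometric i j) (smooth_gamma k i j)).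
Qed.

Lemma smooth_laplacian f : smooth_on U f -> smooth_on U (laplacian f).
Proof.
move=> sf; apply: (smooth_onD oU).
  apply: (smooth_on_sum oU) => i _; apply: (smooth_on_sum oU) => j _.
  apply: (smooth_onM oU (smooth_cometric i j)).
  exact (smooth_pd i (smooth_pd j sf)).
apply: (smooth_on_sum oU) => k _.
exact: (smooth_onM oU (smooth_drift k) (smooth_pd k sf)).
Qed.

Lemma partial_dot i n (F G : 'I_n -> 'rV[R]_m -> R) u :
  (forall c, smooth_on U (F c)) -> (forall c, smooth_on U (G c)) -> U u ->
  pd i (fun w => \sum_c F c w * G c w) u =
  \sum_c (pd i (F c) u * G c u + F c u * pd i (G c) u).
Proof.
move=> sF sG Uu; rewrite (pd_sum oU) //.
  by apply: eq_bigr => c _; exact: (pdM i (sF c) (sG c) Uu).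
by move=> c _; exact: (smooth_onM oU (sF c) (sG c)).
Qed.

Lemma metric_mx_coord u i j : U u ->
  metric_mx X u i j = \sum_c pd i (x c) u * pd j (x c) u.
Proof.
move=> Uu; rewrite mxE; apply: eq_bigr => c _.
by congr (_ * _); [exact: (pd_coord i c sX Uu)|exact: (pd_coord j c sX Uu)].
Qed.

Lemma metric_mxE u : U u -> metric_mx X u = jacobian_mx u *m (jacobian_mx u)^T.
Proof.
move=> Uu; apply/matrixP => i j; rewrite metric_mx_coord// mxE.
by apply: eq_bigr => c _; rewrite !mxE.
Qed.

Lemma metricE u v w : metric X u v w = bilin (metric_mx X u) v w.
Proof. by rewrite bilinE. Qed.

Lemma frame_mx_orthonormal u : U u ->
  frame_mx u *m metric_mx X u *m (frame_mx u)^T = 1%:M.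
Proof.
move=> Uu; apply/matrixP => a b; case: frame_e => _ /(_ u Uu a b) E.
rewrite [RHS]mxE -E metricE /bilin !mxE; apply: eq_bigr => j _; rewrite !mxE; congr (_ * _).
by apply: eq_bigr => i _; rewrite !mxE.
Qed.

Lemma cometric_mxE u : cometric_mx u = (frame_mx u)^T *m frame_mx u.
Proof.
by apply/matrixP => i j; rewrite !mxE; apply: eq_bigr => a _; rewrite !mxE.
Qed.

Lemma cometric_mx_sym u : (cometric_mx u)^T = cometric_mx u.
Proof. by rewrite cometric_mxE trmx_mul trmxK. Qed.

Lemma cometricC u i j : cometric i j u = cometric j i u.
Proof. by apply: eq_bigr => a _; rewrite mulrC. Qed.

(** With E the frame matrix and G the metric, E G E^T = 1 yields G E^T E = 1 and then E^T E G = 1,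
    one-sided inverses being two-sided. *)
Lemma cometric_mxK u : U u -> cometric_mx u *m metric_mx X u = 1%:M.
Proof.
move=> /frame_mx_orthonormal; rewrite -mulmxA => /mulmx1C.
by rewrite -mulmxA -cometric_mxE => /mulmx1C.
Qed.

Lemma invmx_metric u : U u -> invmx (metric_mx X u) = cometric_mx u.
Proof.
move=> Uu; have PG := cometric_mxK Uu; have [_ Gu] := mulmx1_unit PG.
by rewrite -[RHS](mulmxK Gu) PG mul1mx.
Qed.

Lemma hess_gradC u i j l : U u -> hess_grad i j l u = hess_grad j i l u.
Proof.
by move=> Uu; apply: eq_bigr => c _; rewrite (pdC oU i j (smooth_x c) Uu).
Qed.

Lemma partial_metric u i j l : U u ->
  partial i (fun w => metric_mx X w j l) u = hess_grad i j l u + hess_grad i l j u.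
Proof.
move=> Uu; rewrite -pdE (pd_eq_on oU i Uu (fun w Uw => metric_mx_coord j l Uw)).
rewrite (partial_dot _ (smooth_dx j) (smooth_dx l) Uu) big_split; congr (_ + _).
by apply: eq_bigr => c _; rewrite mulrC.
Qed.

(** Each derivative of the metric is a sum of two terms <d_i d_j X, d_l X>; by symmetry of second
    partials four of the six terms cancel and the other two are equal. *)
Lemma christoffelE u k i j : U u -> christoffel X u k i j = gamma k i j u.
Proof.
move=> Uu; rewrite /christoffel invmx_metric// mulr_sumr; apply: eq_bigr => l _.
rewrite !partial_metric// mxE (hess_gradC i j l Uu) (hess_gradC i l j Uu).
rewrite (hess_gradC j l i Uu).
move: (hess_grad j i l u) (hess_grad l i j u) (hess_grad l j i u) (cometric k l u).
by move=> t1 t2 t3 p; field.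
Qed.

Lemma flat_connection_coord n (Z : 'rV[R]_m -> 'rV[R]_n) a c u :
  smooth_on U Z -> U u ->
  flat_connection (e a) Z u 0 c = \sum_j e a u 0 j * pd j (fun w => Z w 0 c) u.
Proof. exact: derive_row_pd. Qed.

Lemma smooth_flat_connection n (Z : 'rV[R]_m -> 'rV[R]_n) a :
  smooth_on U Z -> smooth_on U (flat_connection (e a) Z).
Proof.
move=> sZ; apply: (smooth_on_row oU) => c.
apply: (smooth_on_eq oU (fun u Uu => esym (flat_connection_coord a c sZ Uu))).
apply: (smooth_on_sum oU) => j _; apply: (smooth_onM oU (smooth_frame a j)).
exact (smooth_pd j (smooth_on_coord oU c sZ)).
Qed.

(** The derivatives of the frame produced by D_{e_a} D_{e_a} cancel against the flat part of the
    Levi-Civita derivative of e_a along itself; what remains depends on the frame only through the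
    sums e_a^i e_a^j. *)
Lemma rough_laplacianE (Z : 'rV[R]_m -> 'rV[R]_m.+1) u c :
  smooth_on U Z -> U u ->
  rough_laplacian X e Z u 0 c = laplacian (fun w => Z w 0 c) u.
Proof.
move=> sZ Uu; pose z w : R := Z w 0 c.
have sz : smooth_on U z by exact: smooth_on_coord.
have term a : (flat_connection (e a) (flat_connection (e a) Z) u
      - flat_connection (levi_civita X (e a) (e a)) Z u) 0 c =
    \sum_i \sum_j e a u 0 i * e a u 0 j * pd i (pd j z) u
    - \sum_k (\sum_i \sum_j e a u 0 i * e a u 0 j * gamma k i j u) * pd k z u.
  rewrite mxE [in X in _ + X]mxE.
  rewrite (flat_connection_coord a c (smooth_flat_connection a sZ) Uu).
  rewrite [X in _ - X](derive_row_pd oU _ c sZ Uu) -/z.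
  have -> : \sum_i e a u 0 i * pd i (fun w => flat_connection (e a) Z w 0 c) u =
      \sum_i \sum_j (e a u 0 i * (pd i (fun w => e a w 0 j) u * pd j z u)
                 + e a u 0 i * e a u 0 j * pd i (pd j z) u).
    apply: eq_bigr => i _.
    rewrite (pd_eq_on oU i Uu (fun w Uw => flat_connection_coord a c sZ Uw)).
    rewrite (partial_dot _ (smooth_frame a) (fun j => smooth_pd j sz) Uu).
    rewrite mulr_sumr; apply: eq_bigr => j _; rewrite mulrDr; congr (_ + _).
    exact: mulrA.
  have -> : \sum_k levi_civita X (e a) (e a) u 0 k * pd k z u =
      \sum_k \sum_i e a u 0 i * (pd i (fun w => e a w 0 k) u * pd k z u)
      + \sum_k (\sum_i \sum_j e a u 0 i * e a u 0 j * gamma k i j u) * pd k z u.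
    rewrite -big_split; apply: eq_bigr => k _ /=.
    rewrite mxE (flat_connection_coord a k _ Uu); last by case: frame_e.
    rewrite mxE mulrDl mulr_suml; congr (_ + _ * _).
      by apply: eq_bigr => i _; rewrite mulrA.
    apply: eq_bigr => i _; apply: eq_bigr => j _.
    by rewrite christoffelE// -mulrA [LHS]mulrC.
  rewrite opprD addrA; congr (_ - _).
  under eq_bigr do rewrite big_split /=.
  by rewrite big_split /= exchange_big /= addrAC subrr add0r.
rewrite /rough_laplacian summxE (eq_bigr _ (fun a _ => term a)) sumrB /laplacian.
congr (_ + _).
  rewrite exchange_big; apply: eq_bigr => i _; rewrite exchange_big.
  by apply: eq_bigr => j _; rewrite mulr_suml.
rewrite exchange_big -sumrN; apply: eq_bigr => k _; rewrite -mulr_suml -mulNr.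
congr (- _ * _); rewrite exchange_big; apply: eq_bigr => i _.
by rewrite exchange_big; apply: eq_bigr => j _; rewrite mulr_suml.
Qed.

Lemma laplacian_eq_on f g u : U u -> (forall w, U w -> f w = g w) ->
  laplacian f u = laplacian g u.
Proof.
move=> Uu fg; have dfg i w (Uw : U w) : pd i f w = pd i g w.
  exact: (pd_eq_on oU i Uw fg).
rewrite /laplacian.
have -> : \sum_k drift k u * pd k f u = \sum_k drift k u * pd k g u.
  by apply: eq_bigr => k _; rewrite (dfg k u Uu).
have -> : \sum_i \sum_j cometric i j u * pd i (pd j f) u
        = \sum_i \sum_j cometric i j u * pd i (pd j g) u.
  apply: eq_bigr => i _; apply: eq_bigr => j _.
  by rewrite (pd_eq_on oU i Uu (dfg j)).
by [].
Qed.

Lemma laplacian_cst (a : R) u : laplacian (fun=> a) u = 0.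
Proof.
rewrite /laplacian big1 ?add0r => [|i _].
  by rewrite big1// => k _; rewrite pd_cst mulr0.
rewrite big1// => j _.
rewrite (_ : pd j (fun=> a) = fun=> 0) ?pd_cst ?mulr0//.
by apply/funext => w; rewrite pd_cst.
Qed.

Lemma laplacian_sum (I : finType) (F : I -> 'rV[R]_m -> R) u :
  (forall c, smooth_on U (F c)) -> U u ->
  laplacian (fun w => \sum_c F c w) u = \sum_c laplacian (F c) u.
Proof.
move=> sF Uu; have dF i w (Uw : U w) :
    pd i (fun w => \sum_c F c w) w = \sum_c pd i (F c) w.
  exact: (pd_sum oU _ i (fun c _ => sF c) Uw).
rewrite /laplacian big_split /=; congr (_ + _); rewrite [RHS]exchange_big /=.
  apply: eq_bigr => i _; rewrite [RHS]exchange_big /=; apply: eq_bigr => j _.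
  rewrite -mulr_sumr (pd_eq_on oU i Uu (dF j)); congr (_ * _).
  exact: (pd_sum oU _ i (fun c _ => smooth_pd j (sF c)) Uu).
by apply: eq_bigr => k _; rewrite dF// mulr_sumr.
Qed.

Lemma laplacianM f g u : smooth_on U f -> smooth_on U g -> U u ->
  laplacian (fun w => f w * g w) u =
  f u * laplacian g u + g u * laplacian f u
  + 2 * \sum_i \sum_j cometric i j u * (pd i f u * pd j g u).
Proof.
move=> sf sg Uu.
have dfg i w (Uw : U w) : pd i (fun w => f w * g w) w =
    pd i f w * g w + f w * pd i g w by exact: (pdM i sf sg Uw).
have ddfg i j : pd i (pd j (fun w => f w * g w)) u =
   pd i (pd j f) u * g u + f u * pd i (pd j g) u
   + (pd j f u * pd i g u + pd i f u * pd j g u).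
  rewrite (pd_eq_on oU i Uu (dfg j)).
  have sdf := smooth_pd j sf; have sdg := smooth_pd j sg.
  rewrite (pdD _ (smooth_onM oU sdf sg) (smooth_onM oU sf sdg) Uu).
  rewrite (pdM i sdf sg Uu) (pdM i sf sdg Uu).
  by ring.
have E1 : \sum_i \sum_j cometric i j u * pd i (pd j (fun w => f w * g w)) u
   = g u * (\sum_i \sum_j cometric i j u * pd i (pd j f) u)
   + f u * (\sum_i \sum_j cometric i j u * pd i (pd j g) u)
   + 2 * \sum_i \sum_j cometric i j u * (pd i f u * pd j g u).
  have sw : \sum_i \sum_j cometric i j u * (pd i f u * pd j g u) =
      \sum_i \sum_j cometric i j u * (pd j f u * pd i g u).
    rewrite exchange_big; apply: eq_bigr => i _; apply: eq_bigr => j _.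
    by rewrite cometricC.
  rewrite mulr_natl mulr2n {2}sw !mulr_sumr -!big_split /=.
  apply: eq_bigr => i _; rewrite !mulr_sumr -!big_split /=; apply: eq_bigr => j _.
  by rewrite ddfg; ring.
have E2 : \sum_k drift k u * pd k (fun w => f w * g w) u
   = g u * (\sum_k drift k u * pd k f u)
   + f u * (\sum_k drift k u * pd k g u).
  rewrite !mulr_sumr -!big_split /=; apply: eq_bigr => k _.
  by rewrite dfg//; ring.
by rewrite /laplacian E1 E2; ring.
Qed.

(** [gamma] is the tangential part of the second derivatives of X: lowering its index returns
    [hess_grad], so the drift term removes exactly the tangential part of the second-order term. *)
Lemma laplacian_tangent u l : U u ->
  \sum_c laplacian (x c) u * pd l (x c) u = 0.
Proof.
move=> Uu; rewrite /laplacian.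
have gammaG i j : \sum_k gamma k i j u * metric_mx X u k l = hess_grad i j l u.
  transitivity (\sum_n \sum_k cometric n k u * metric_mx X u k l * hess_grad i j n u).
    rewrite exchange_big; apply: eq_bigr => k _; rewrite mulr_suml.
    by apply: eq_bigr => n _; rewrite cometricC mulrAC.
  transitivity (\sum_n (cometric_mx u *m metric_mx X u) n l * hess_grad i j n u).
    apply: eq_bigr => n _; rewrite mxE mulr_suml; apply: eq_bigr => k _.
    by rewrite [in RHS]mxE.
  rewrite cometric_mxK// (bigD1 l)//= mxE eqxx mul1r big1 ?addr0// => n nl.
  by rewrite mxE (negbTE nl) mul0r.
under eq_bigr do rewrite mulrDl.
rewrite big_split /=.
have -> : \sum_c (\sum_i \sum_j cometric i j u * pd i (pd j (x c)) u)
      * pd l (x c) u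
    = \sum_i \sum_j cometric i j u * hess_grad i j l u.
  under eq_bigr do rewrite mulr_suml.
  rewrite exchange_big /=; apply: eq_bigr => i _.
  under eq_bigr do rewrite mulr_suml.
  rewrite exchange_big /=; apply: eq_bigr => j _.
  by rewrite mulr_sumr; apply: eq_bigr => c _; rewrite mulrA.
have -> : \sum_c (\sum_k drift k u * pd k (x c) u) * pd l (x c) u
    = \sum_k drift k u * metric_mx X u k l.
  under eq_bigr do rewrite mulr_suml.
  rewrite exchange_big /=; apply: eq_bigr => k _.
  rewrite metric_mx_coord// mulr_sumr.
  by apply: eq_bigr => c _; rewrite mulrA.
apply/eqP; rewrite addr_eq0 -sumrN; apply/eqP.
transitivity (\sum_k \sum_i \sum_j cometric i j u * (gamma k i j u * metric_mx X u k l)).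
  rewrite [RHS]exchange_big /=; apply: eq_bigr => i _.
  rewrite [RHS]exchange_big /=; apply: eq_bigr => j _.
  by rewrite -mulr_sumr gammaG.
apply: eq_bigr => k _; rewrite mulNr opprK mulr_suml; apply: eq_bigr => i _.
by rewrite mulr_suml; apply: eq_bigr => j _; rewrite mulrA.
Qed.

End LocalHypersurface.

(** * Structure equations of a hypersurface *)

Lemma mxtrace_mulmxE (R : pzSemiRingType) p q (A : 'M[R]_(p, q)) (B : 'M[R]_(q, p)) :
  \tr (A *m B) = \sum_i \sum_j A i j * B j i.
Proof. by apply: eq_bigr => i _; rewrite mxE. Qed.

Lemma mxtrace_mul_tr_eq0 (R : realDomainType) p q (A : 'M[R]_(p, q)) :
  \tr (A *m A^T) = 0 -> A = 0.
Proof.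
rewrite mxtrace_mulmxE pair_big /= => A0; apply/matrixP => i j; rewrite mxE.
have /(_ (i, j)) : forall t : 'I_p * 'I_q, A t.1 t.2 * A^T t.2 t.1 = 0.
  move=> t; apply: (psumr_eq0P _ A0) => // [{}t _].
  by rewrite mxE -expr2 sqr_ge0.
by rewrite /= mxE => /eqP; rewrite mulf_eq0 orbb => /eqP.
Qed.

Section UnitNormal.
Variables (R : realType) (m : nat) (U : set 'rV[R]_m).
Variables (X : 'rV[R]_m -> 'rV[R]_m.+1) (e : 'I_m -> 'rV[R]_m -> 'rV[R]_m).
Variable nu : 'rV[R]_m -> 'rV[R]_m.+1.
Hypotheses (oU : open U) (sX : smooth_on U X) (frame_e : orthonormal_frame X U e).
Hypothesis snu : smooth_on U nu.
Implicit Types (f g : 'rV[R]_m -> R) (u v : 'rV[R]_m) (i j k l : 'I_m).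

Let x (c : 'I_m.+1) u : R := X u 0 c.
Let n (c : 'I_m.+1) u : R := nu u 0 c.
Let P := cometric e.
Let L := laplacian X e.
Let q := drift X e.
Let J := jacobian_mx X.

Hypothesis nn : forall u, U u -> \sum_c n c u * n c u = 1.
Hypothesis xn : forall u l, U u -> \sum_c pd l (x c) u * n c u = 0.

Definition normal_jacobian_mx u : 'M[R]_(m, m.+1) := \matrix_(i, c) pd i (n c) u.

(** The Levi-Civita correction is tangent to the hypersurface, hence absent after pairing with
    nu. *)
Definition second_form_mx u : 'M[R]_m :=
  \matrix_(i, j) \sum_c pd i (pd j (x c)) u * n c u.

(* m times the scalar mean curvature, since the Laplacian of the position
   vector is m times the mean curvature vector. *)
Definition total_curvature u : R := \sum_c L (x c) u * n c u.

Let N := normal_jacobian_mx.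
Let B := second_form_mx.
Let h := total_curvature.

Let sx c : smooth_on U (x c). Proof. exact: (smooth_on_coord oU c sX). Qed.
Let sn c : smooth_on U (n c). Proof. exact: (smooth_on_coord oU c snu). Qed.
Let sdx i c : smooth_on U (pd i (x c)). Proof. exact (smooth_pd i (sx c)). Qed.
Let sP i j : smooth_on U (P i j). Proof. exact: smooth_cometric oU frame_e i j. Qed.
Let sq k : smooth_on U (q k). Proof. exact: smooth_drift oU sX frame_e k. Qed.
Let sL f : smooth_on U f -> smooth_on U (L f).
Proof. by move=> sf; exact (smooth_laplacian oU sX frame_e sf). Qed.

Lemma smooth_total_curvature : smooth_on U h.
Proof. by apply: (smooth_on_sum oU) => c _; exact: (smooth_onM oU (sL (sx c)) (sn c)). Qed.

Lemma normal_unit_mx u : U u -> nu u *m (nu u)^T = 1%:M.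
Proof.
move=> Uu; apply/matrixP => a b; rewrite !ord1 !mxE eqxx -(nn Uu).
by apply: eq_bigr => c _; rewrite mxE.
Qed.

Lemma jacobian_normal u : U u -> J u *m (nu u)^T = 0.
Proof.
move=> Uu; apply/matrixP => l a; rewrite ord1 !mxE -[RHS](xn l Uu).
by apply: eq_bigr => c _; rewrite !mxE.
Qed.

Lemma cometric_jacobian u : U u -> cometric_mx e u *m (J u *m (J u)^T) = 1%:M.
Proof. by move=> Uu; rewrite -(metric_mxE sX Uu) (cometric_mxK frame_e). Qed.

Lemma normal_pd_normal u i : U u -> \sum_c pd i (n c) u * n c u = 0.
Proof.
move=> Uu.
have : pd i (fun w => \sum_c n c w * n c w) u = 0.
  by rewrite (pd_eq_on oU i Uu nn) pd_cst.
rewrite (partial_dot oU _ sn sn Uu) big_split /=.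
have -> : \sum_c n c u * pd i (n c) u = \sum_c pd i (n c) u * n c u.
  by apply: eq_bigr => c _; rewrite mulrC.
by move=> /eqP; rewrite -mulr2n mulrn_eq0 /= => /eqP.
Qed.

Lemma normal_jacobian_normal u : U u -> N u *m (nu u)^T = 0.
Proof.
move=> Uu; apply/matrixP => i a; rewrite ord1 !mxE -[RHS](normal_pd_normal i Uu).
by apply: eq_bigr => c _; rewrite !mxE.
Qed.

Lemma second_form_mxE u : U u -> B u = - (N u *m (J u)^T).
Proof.
move=> Uu; apply/matrixP => i j; rewrite !mxE.
have : pd i (fun w => \sum_c pd j (x c) w * n c w) u = 0.
  by rewrite (pd_eq_on oU i Uu (fun w Uw => xn j Uw)) pd_cst.
rewrite (partial_dot oU _ (sdx j) sn Uu) big_split /= => /eqP.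
rewrite addr_eq0 => /eqP ->; congr (- _).
by apply: eq_bigr => c _; rewrite !mxE mulrC.
Qed.

Lemma second_form_mx_sym u : U u -> (B u)^T = B u.
Proof.
move=> Uu; apply/matrixP => i j; rewrite !mxE; apply: eq_bigr => c _.
by rewrite (pdC oU i j (sx c) Uu).
Qed.

(** As |nu| = 1, the derivatives of nu have no normal part; their tangential coefficients come from
    [second_form_mxE]. *)
Lemma weingarten u : U u -> N u = - (B u *m cometric_mx e u *m J u).
Proof.
move=> Uu.
rewrite {1}[N u](normal_frame_decomp (cometric_jacobian Uu) (jacobian_normal Uu)
  (normal_unit_mx Uu)).
rewrite normal_jacobian_normal// mul0mx addr0.
by rewrite -[N u *m _]opprK -second_form_mxE// !mulNmx.
Qed.

Lemma laplacian_normal_part c u : U u -> L (x c) u = h u * n c u.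
Proof.
move=> Uu; pose W : 'rV[R]_m.+1 := \row_c L (x c) u.
have WJ : W *m (J u)^T = 0.
  apply/matrixP => a l; rewrite !mxE -[RHS](laplacian_tangent sX frame_e l Uu).
  by apply: eq_bigr => d _; rewrite !mxE.
have WnE : W *m (nu u)^T = (h u)%:M.
  apply/matrixP => a b; rewrite !ord1 !mxE eqxx mulr1n.
  by apply: eq_bigr => d _; rewrite !mxE.
have := normal_frame_decomp (cometric_jacobian Uu) (jacobian_normal Uu)
  (normal_unit_mx Uu) W.
rewrite WJ !mul0mx add0r WnE mul_scalar_mx => /matrixP/(_ 0 c).
by rewrite !mxE.
Qed.

(** * The traced Codazzi equation *)

Section Codazzi.
Variables (u : 'rV[R]_m) (l : 'I_m).
Hypothesis Uu : U u.

Let K : 'M[R]_(m, m.+1) := \matrix_(i, c) pd l (pd i (x c)) u.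
Let dP : 'M[R]_m := \matrix_(i, j) pd l (P i j) u.
Let Pu := cometric_mx e u.

(** Differentiating P G = 1 gives dP = - P dG P, with G = J J^T. *)
Let dP_eq : dP = - (Pu *m (K *m (J u)^T + J u *m K^T) *m Pu).
Proof.
pose G (i j : 'I_m) w := \sum_c pd i (x c) w * pd j (x c) w.
have sG i j : smooth_on U (G i j).
  by apply: (smooth_on_sum oU) => c _; exact: (smooth_onM oU (sdx i c) (sdx j c)).
have PG i j w : U w -> \sum_k P i k w * G k j w = (i == j)%:R.
  move=> Uw; have /matrixP/(_ i j) := cometric_jacobian Uw.
  rewrite !mxE => <-; apply: eq_bigr => k _; rewrite !mxE; congr (_ * _).
  by apply: eq_bigr => c _; rewrite !mxE.
pose dG : 'M[R]_m := K *m (J u)^T + J u *m K^T.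
have dGE i j : pd l (G i j) u = dG i j.
  rewrite (partial_dot oU _ (sdx i) (sdx j) Uu) big_split !mxE.
  by congr (_ + _); apply: eq_bigr => c _; rewrite !mxE.
have PJ := cometric_jacobian Uu.
have dPG : dP *m (J u *m (J u)^T) = - (Pu *m dG).
  apply/matrixP => i j; rewrite !mxE.
  have : pd l (fun w => \sum_k P i k w * G k j w) u = 0.
    by rewrite (pd_eq_on oU l Uu (PG i j)) pd_cst.
  rewrite (partial_dot oU _ (sP i) (fun k => sG k j) Uu) big_split /= => /eqP.
  rewrite addr_eq0 => /eqP E.
  transitivity (\sum_k pd l (P i k) u * G k j u).
    apply: eq_bigr => k _; rewrite !mxE; congr (_ * _).
    by apply: eq_bigr => c _; rewrite !mxE.
  rewrite E; congr (- _); apply: eq_bigr => k _.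
  by rewrite dGE [Pu _ _]mxE.
have GP : J u *m (J u)^T *m Pu = 1%:M by exact: mulmx1C.
by rewrite -[LHS]mulmx1 -GP mulmxA dPG mulNmx.
Qed.

(** The trace common to both expansions compared in [codazzi_trace], where it cancels. *)
Let tau : R := \tr (Pu *m K *m (J u)^T *m Pu *m B u).

Let tr_dP : \sum_i \sum_j pd l (P i j) u * B u i j = - (tau + tau).
Proof.
transitivity (\tr (dP *m B u)).
  rewrite mxtrace_mulmxE; apply: eq_bigr => i _; apply: eq_bigr => j _.
  by rewrite -[in RHS]second_form_mx_sym// [dP _ _]mxE [(B u)^T _ _]mxE.
rewrite dP_eq mulNmx raddfN /=; congr (- _).
rewrite mulmxDr !mulmxDl raddfD /=; congr (_ + _); first by rewrite !mulmxA.
(* The two halves of dG are transposes of each other and P, B are symmetric, so both traces equal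
   [tau]. *)
rewrite -mxtrace_tr !trmx_mul trmxK second_form_mx_sym// cometric_mx_sym.
by rewrite mxtrace_mulC !mulmxA.
Qed.

Let tr_KN : \sum_i \sum_j P i j u * (\sum_c pd i (pd l (x c)) u * pd j (n c) u)
  = - tau.
Proof.
transitivity (\tr (Pu *m (N u *m K^T))).
  rewrite mxtrace_mulmxE; apply: eq_bigr => i _; apply: eq_bigr => j _.
  rewrite [Pu _ _]mxE [in RHS]mxE; congr (_ * _); apply: eq_bigr => c _.
  by rewrite !mxE mulrC (pdC oU i l (sx c) Uu).
rewrite weingarten// mulNmx mulmxN raddfN /=; congr (- _).
rewrite /tau -mxtrace_tr !trmx_mul !trmxK second_form_mx_sym// cometric_mx_sym.
by rewrite mulmxA mxtrace_mulC !mulmxA mxtrace_mulC !mulmxA.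
Qed.

(** This is L applied to <d_l X, nu> = 0; the cross term of the product rule is twice the sum in
    [tr_KN]. *)
Let laplacian_normal_x :
  \sum_c (pd l (x c) u * L (n c) u + n c u * L (pd l (x c)) u) = tau + tau.
Proof.
have : L (fun w => \sum_c pd l (x c) w * n c w) u = 0.
  by rewrite /L (laplacian_eq_on X e oU Uu (fun w Uw => xn l Uw)) laplacian_cst.
have sxn c : smooth_on U (fun w => pd l (x c) w * n c w).
  exact: (smooth_onM oU (sdx l c) (sn c)).
rewrite /L (laplacian_sum X e oU sxn Uu).
have E c := laplacianM X e oU (sdx l c) (sn c) Uu.
rewrite (eq_bigr _ (fun c _ => E c)) big_split /= => /eqP.
rewrite addr_eq0 => /eqP ->; rewrite -mulr_sumr.
have -> : \sum_c \sum_i \sum_j cometric e i j u * (pd i (pd l (x c)) u * pd j (n c) u)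
   = - tau.
  rewrite -tr_KN exchange_big; apply: eq_bigr => i _.
  by rewrite exchange_big; apply: eq_bigr => j _; rewrite mulr_sumr.
by rewrite mulrN opprK mulr_natl mulr2n.
Qed.

Let pd_laplacian f : smooth_on U f ->
  pd l (L f) u = \sum_i \sum_j pd l (P i j) u * pd i (pd j f) u
    + \sum_k pd l (q k) u * pd k f u + L (pd l f) u.
Proof.
move=> sf.
have sddf i j : smooth_on U (pd i (pd j f)) by exact (smooth_pd i (smooth_pd j sf)).
have sdf i : smooth_on U (pd i f) by exact (smooth_pd i sf).
have s1 i : smooth_on U (fun w => \sum_j P i j w * pd i (pd j f) w).
  by apply: (smooth_on_sum oU) => j _; exact: (smooth_onM oU (sP i j) (sddf i j)).
have s2 : smooth_on U (fun w => \sum_i \sum_j P i j w * pd i (pd j f) w).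
  by apply: (smooth_on_sum oU) => i _; exact (s1 i).
have s3 : smooth_on U (fun w => \sum_k q k w * pd k f w).
  by apply: (smooth_on_sum oU) => k _; exact: (smooth_onM oU (sq k) (sdf k)).
rewrite (pdD l s2 s3 Uu) (pd_sum oU _ l (fun i _ => s1 i) Uu).
rewrite (partial_dot oU _ sq sdf Uu) big_split /=.
have -> : \sum_i pd l (fun w => \sum_j P i j w * pd i (pd j f) w) u =
    \sum_i \sum_j pd l (P i j) u * pd i (pd j f) u
    + \sum_i \sum_j P i j u * pd i (pd j (pd l f)) u.
  rewrite -big_split; apply: eq_bigr => i _.
  rewrite (partial_dot oU _ (sP i) (sddf i) Uu) big_split; congr (_ + _).
  apply: eq_bigr => j _; rewrite (pdC oU l i (sdf j) Uu).
  by rewrite (pd_eq_on oU i Uu (fun w Uw => pdC oU l j sf Uw)).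
have -> : \sum_k q k u * pd l (pd k f) u = \sum_k q k u * pd k (pd l f) u.
  by apply: eq_bigr => k _; rewrite (pdC oU l k sf Uu).
by rewrite /L /laplacian addrACA.
Qed.

(** [E] differentiates L X = h nu and pairs it with nu. [E2] expands the same quantity by commuting
    d_l with L: derivatives of the drift multiply tangent vectors and drop out, derivatives of the
    cometric give - 2 [tau], which cancels against [laplacian_normal_x]. *)
Lemma codazzi_trace : \sum_c L (n c) u * pd l (x c) u = - pd l h u.
Proof.
have E : \sum_c pd l (L (x c)) u * n c u = pd l h u.
  have Ec c : pd l (L (x c)) u * n c u =
      pd l h u * (n c u * n c u) + h u * (pd l (n c) u * n c u).
    rewrite (pd_eq_on oU l Uu (fun w Uw => laplacian_normal_part c Uw)).
    rewrite (pdM l smooth_total_curvature (sn c) Uu) mulrDl.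
    by rewrite -!mulrA.
  rewrite (eq_bigr _ (fun c _ => Ec c)) big_split /= -!mulr_sumr nn//.
  by rewrite normal_pd_normal// mulr0 addr0 mulr1.
have E2 : pd l h u = - (tau + tau) + \sum_c n c u * L (pd l (x c)) u.
  rewrite -E -tr_dP.
  have Ec c : pd l (L (x c)) u * n c u =
      (\sum_i \sum_j pd l (P i j) u * (pd i (pd j (x c)) u * n c u)
      + \sum_k pd l (q k) u * (pd k (x c) u * n c u)) + n c u * L (pd l (x c)) u.
    rewrite (pd_laplacian (sx c)) mulrDl mulrDl; congr (_ + _ + _); last first.
    - exact: mulrC.
    - by rewrite mulr_suml; apply: eq_bigr => k _; rewrite mulrA.
    rewrite mulr_suml; apply: eq_bigr => i _; rewrite mulr_suml.
    by apply: eq_bigr => j _; rewrite mulrA.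
  rewrite (eq_bigr _ (fun c _ => Ec c)) 2!big_split /=; congr (_ + _).
  rewrite [X in _ + X]exchange_big [X in _ + X]big1 => [|k _]; last first.
    by rewrite -mulr_sumr xn// mulr0.
  rewrite addr0 exchange_big; apply: eq_bigr => i _.
  rewrite exchange_big; apply: eq_bigr => j _.
  by rewrite -mulr_sumr mxE.
have := laplacian_normal_x; rewrite big_split /= E2.
have -> : \sum_c pd l (x c) u * L (n c) u = \sum_c L (n c) u * pd l (x c) u.
  by apply: eq_bigr => c _; rewrite mulrC.
move=> <-; ring.
Qed.

End Codazzi.

(** * Consequences of biharmonicity and convexity *)

Section Biharmonic.
Hypothesis B_ge0 : forall u v, U u -> 0 <= bilin (B u) v v.
Hypothesis Lh : forall u c, U u -> L (fun w => h w * n c w) u = 0.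

Let sh : smooth_on U h := smooth_total_curvature.

Let LhE u c : U u -> 0 = h u * L (n c) u + n c u * L h u
  + 2 * \sum_i \sum_j P i j u * (pd i h u * pd j (n c) u).
Proof.
by move=> Uu; rewrite -[LHS](Lh c Uu); exact: (laplacianM X e oU sh (sn c) Uu).
Qed.

Lemma total_curvatureE u : U u -> h u = \sum_i \sum_j P i j u * B u i j.
Proof.
move=> Uu; rewrite /h /total_curvature.
have E c : L (x c) u * n c u =
    \sum_i \sum_j P i j u * (pd i (pd j (x c)) u * n c u)
    + \sum_k q k u * (pd k (x c) u * n c u).
  rewrite /L /laplacian mulrDl; congr (_ + _); rewrite mulr_suml.
    apply: eq_bigr => i _; rewrite mulr_suml; apply: eq_bigr => j _.
    by rewrite mulrA.
  by apply: eq_bigr => k _; rewrite mulrA.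
rewrite (eq_bigr _ (fun c _ => E c)) big_split /=.
rewrite [X in _ + X]exchange_big [X in _ + X]big1 => [|k _]; last first.
  by rewrite -mulr_sumr xn// mulr0.
rewrite addr0 exchange_big; apply: eq_bigr => i _.
rewrite exchange_big; apply: eq_bigr => j _.
by rewrite -mulr_sumr mxE.
Qed.

Lemma total_curvature_ge0 u : U u -> 0 <= h u.
Proof.
move=> Uu; rewrite (total_curvatureE Uu).
suff -> : \sum_i \sum_j P i j u * B u i j = \sum_a bilin (B u) (e a u) (e a u).
  by apply: sumr_ge0 => a _; exact: B_ge0.
transitivity (\sum_a \sum_i \sum_j B u i j * e a u 0 i * e a u 0 j); last first.
  by apply: eq_bigr => a _; rewrite bilinE.
rewrite [RHS]exchange_big; apply: eq_bigr => i _.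
rewrite [RHS]exchange_big; apply: eq_bigr => j _.
rewrite /P /cometric mulr_suml; apply: eq_bigr => a _.
by rewrite [LHS]mulrC mulrA.
Qed.

(** The inner product of [LhE] with d_l X: the term along nu disappears, [codazzi_trace] replaces <L
    nu, d_l X>, and <d_j nu, d_l X> = - B_jl. *)
Lemma tangential_equation u l : U u ->
  h u * pd l h u = - (2 * \sum_i \sum_j P i j u * (pd i h u * B u j l)).
Proof.
move=> Uu.
have E : 0 = \sum_c (h u * (L (n c) u * pd l (x c) u)
    + L h u * (pd l (x c) u * n c u)
    + 2 * \sum_i \sum_j P i j u * (pd i h u * (pd j (n c) u * pd l (x c) u))).
  rewrite big1 // => c _.
  have -> : \sum_i \sum_j P i j u * (pd i h u * (pd j (n c) u * pd l (x c) u))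
      = (\sum_i \sum_j P i j u * (pd i h u * pd j (n c) u)) * pd l (x c) u.
    rewrite mulr_suml; apply: eq_bigr => i _; rewrite mulr_suml.
    by apply: eq_bigr => j _; rewrite !mulrA.
  transitivity (0 * pd l (x c) u); last exact: mul0r.
  by rewrite [X in _ = X * _](LhE c Uu); ring.
move: E; rewrite 2!big_split /= -!mulr_sumr codazzi_trace// xn// mulr0 addr0.
rewrite mulrN => /esym /eqP; rewrite addrC subr_eq0 => /eqP <-.
rewrite -mulrN; congr (2 * _).
rewrite exchange_big -sumrN; apply: eq_bigr => i _.
rewrite exchange_big -sumrN; apply: eq_bigr => j _.
rewrite -!mulr_sumr -!mulrN; congr (_ * (_ * _)).
rewrite second_form_mxE// [in RHS]mxE [in RHS]mxE opprK; apply: eq_bigr => c _.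
by rewrite !mxE.
Qed.

Lemma pd_total_curvature u l : U u -> 0 < h u -> pd l h u = 0.
Proof.
move=> Uu h0; pose dh : 'rV[R]_m := \row_i pd i h u.
pose Pu := cometric_mx e u; pose E := frame_mx e u.
have dhE : h u *: dh = - 2 *: (dh *m Pu *m B u).
  apply/rowP => k; rewrite [LHS]mxE [dh _ _]mxE tangential_equation// mxE mulNr.
  congr (- (2 * _)); rewrite [RHS]mxE exchange_big; apply: eq_bigr => j _.
  rewrite [(dh *m _) _ _]mxE mulr_suml; apply: eq_bigr => i _.
  by rewrite [dh _ _]mxE [Pu _ _]mxE mulrA [P i j u * _]mulrC.
have PE : Pu = E^T *m E by exact: cometric_mxE.
pose w := dh *m Pu.
(* The row [dh *m E^T] holds the derivatives of h along the frame, so the trace is |grad h|^2, while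
   w = grad h: this is h |grad h|^2 = - 2 b(grad h, grad h). *)
have trE : h u * \tr ((dh *m E^T) *m (dh *m E^T)^T) = - (2 * bilin (B u) w w).
  have -> : (dh *m E^T) *m (dh *m E^T)^T = dh *m w^T.
    by rewrite /w !trmx_mul trmxK cometric_mx_sym -/Pu PE !mulmxA.
  rewrite /mxtrace big_ord1; transitivity (((h u *: dh) *m w^T) 0 0).
    by rewrite -scalemxAl [RHS]mxE.
  by rewrite dhE -scalemxAl [LHS]mxE mulNr.
have tr0 : \tr ((dh *m E^T) *m (dh *m E^T)^T) = 0.
  apply/eqP; rewrite eq_le; apply/andP; split.
    rewrite -(pmulr_rle0 _ h0) trE oppr_le0 mulr_ge0//; exact: B_ge0.
  rewrite mxtrace_mulmxE; apply: sumr_ge0 => i _; apply: sumr_ge0 => j _.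
  by rewrite [_^T _ _]mxE -expr2 sqr_ge0.
have dE0 := mxtrace_mul_tr_eq0 tr0.
have : dh *m Pu *m metric_mx X u = 0 by rewrite PE mulmxA dE0 !mul0mx.
rewrite -mulmxA (cometric_mxK frame_e)// mulmx1 => /matrixP/(_ 0 l).
by rewrite !mxE.
Qed.

(** Here [LhE] reduces to h L nu = 0, so <nu, L nu> = 0, and L applied to |nu|^2 = 1 leaves |d nu|^2
    = 0. *)
Lemma normal_equation u : U u -> L h u = 0 -> (forall i, pd i h u = 0) -> h u != 0 ->
  N u = 0.
Proof.
move=> Uu Lh0 dh0 h0.
have nLn : \sum_c n c u * L (n c) u = 0.
  apply: (mulfI h0); rewrite mulr0 mulr_sumr big1// => c _.
  have := LhE c Uu; rewrite Lh0 mulr0 addr0 big1 => [|i _]; last first.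
    by rewrite big1// => j _; rewrite dh0 mul0r mulr0.
  by rewrite mulr0 addr0 mulrCA => <-; rewrite mulr0.
have : L (fun w => \sum_c n c w * n c w) u = 0.
  by rewrite /L (laplacian_eq_on X e oU Uu nn) laplacian_cst.
have snn c : smooth_on U (fun w => n c w * n c w) := smooth_onM oU (sn c) (sn c).
rewrite /L (laplacian_sum X e oU snn Uu).
have E c := laplacianM X e oU (sn c) (sn c) Uu.
rewrite (eq_bigr _ (fun c _ => E c)) !big_split /= nLn addr0 add0r -mulr_sumr.
move=> /eqP; rewrite mulf_eq0 pnatr_eq0 /= => /eqP S0.
pose F := frame_mx e u.
(* |d nu|^2 = tr (P N N^T) becomes a sum of squares through P = F^T F. *)
have tr0 : \tr ((F *m N u) *m (F *m N u)^T) = 0.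
  transitivity (\tr (cometric_mx e u *m (N u *m (N u)^T))).
    by rewrite trmx_mul cometric_mxE !mulmxA [LHS]mxtrace_mulC !mulmxA.
  rewrite mxtrace_mulmxE -[RHS]S0 [RHS]exchange_big; apply: eq_bigr => i _.
  rewrite [RHS]exchange_big; apply: eq_bigr => j _.
  rewrite -mulr_sumr [cometric_mx _ _ _ _]mxE [in LHS]mxE; congr (_ * _).
  by apply: eq_bigr => c _; rewrite !mxE mulrC.
have FN0 := mxtrace_mul_tr_eq0 tr0.
have PN0 : cometric_mx e u *m N u = 0 by rewrite cometric_mxE -mulmxA FN0 mulmx0.
have := congr1 (fun M => metric_mx X u *m M) PN0.
by rewrite /= mulmx0 mulmxA (mulmx1C (cometric_mxK frame_e Uu)) mul1mx.
Qed.

Theorem total_curvature_eq0 u : U u -> h u = 0.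
Proof.
move=> Uu; apply/eqP; apply: contraT => hn0.
have h0 : 0 < h u by rewrite lt_def hn0 total_curvature_ge0.
pose V := [set w | U w /\ 0 < h w].
have oV : open V.
  rewrite openE => w [Uw hw]; apply: filterI; first exact: open_nbhs_nbhs.
  have hw2 : 0 < h w / 2 by rewrite divr_gt0.
  have := near_close sh Uw hw2; apply: filterS => z.
  by rewrite ler_norml => /andP[_ ?]; lra.
have Lh0 : L h u = 0.
  rewrite /L /laplacian big1 => [|i _]; last first.
    rewrite big1// => j _.
    rewrite (@pd_eq_on _ _ V oV (pd j h) (fun=> 0) i u) ?pd_cst ?mulr0//.
    by move=> w [Uw hw]; exact: pd_total_curvature.
  by rewrite add0r big1// => k _; rewrite pd_total_curvature ?mulr0.
have N0 := normal_equation Uu Lh0 (fun i => pd_total_curvature i Uu h0) hn0.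
suff : h u = 0 by move=> hu0; rewrite hu0 eqxx in hn0.
rewrite (total_curvatureE Uu) second_form_mxE// N0 mul0mx oppr0 big1// => i _.
by rewrite big1// => j _; rewrite mxE mulr0.
Qed.

End Biharmonic.

End UnitNormal.

(** * Local frames *)

Section LocalFrame.
Variables (R : realType) (m : nat) (U : set 'rV[R]_m) (X : 'rV[R]_m -> 'rV[R]_m.+1).
Hypotheses (oU : open U) (sX : smooth_on U X).

Lemma metric_mx_sym u : (metric_mx X u)^T = metric_mx X u.
Proof.
by apply/matrixP => i j; rewrite !mxE; apply: eq_bigr => c _; exact: mulrC.
Qed.

Lemma derive_row_jacobian u v : U u -> 'D_v X u = v *m jacobian_mx X u.
Proof.
move=> Uu; apply/rowP => c; rewrite (derive_row_pd oU v c sX Uu) mxE.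
by apply: eq_bigr => i _; rewrite mxE.
Qed.

(** The metric evaluated on v twice is |dX(v)|^2, so definiteness is injectivity of the
    differential. *)
Lemma metric_gt0 u v : U u -> injective ('d X u : 'rV[R]_m -> 'rV[R]_m.+1) ->
  v != 0 -> 0 < metric X u v v.
Proof.
move=> Uu inj_dX v0.
have E : metric X u v v = \tr ('D_v X u *m ('D_v X u)^T).
  rewrite metricE /bilin (metric_mxE sX Uu) derive_row_jacobian//.
  by rewrite /mxtrace big_ord1 trmx_mul !mulmxA.
rewrite lt_def; apply/andP; split; last first.
  rewrite E mxtrace_mulmxE; apply: sumr_ge0 => i _; apply: sumr_ge0 => j _.
  by rewrite mxE -expr2 sqr_ge0.
apply/eqP => metric0; move/eqP: v0; apply; apply: inj_dX.
rewrite linear0 -deriveE; first exact: (mxtrace_mul_tr_eq0 (etrans (esym E) metric0)).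
exact: (smooth_on_differentiable_row oU sX Uu).
Qed.

Lemma smooth_metric (v w : 'rV[R]_m -> 'rV[R]_m) :
  (forall i, smooth_on U (fun u => v u 0 i)) ->
  (forall i, smooth_on U (fun u => w u 0 i)) ->
  smooth_on U (fun u => metric X u (v u) (w u)).
Proof.
move=> sv sw.
apply: (smooth_on_sum oU) => i _; apply: (smooth_on_sum oU) => j _.
apply: (smooth_onM oU _ (sw j)); apply: (smooth_onM oU _ (sv i)).
apply: (smooth_on_eq oU (fun u Uu => esym (metric_mx_coord sX i j Uu))).
apply: (smooth_on_sum oU) => c _.
have s k : smooth_on U (pd k (fun u => X u 0 c)).
  exact (smooth_pd k (smooth_on_coord oU c sX)).
exact: (smooth_onM oU (s i) (s j)).
Qed.

Lemma smooth_on_rowZ (f : 'rV[R]_m -> R) (v : 'rV[R]_m -> 'rV[R]_m) i :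
  smooth_on U f -> smooth_on U (fun u => v u 0 i) ->
  smooth_on U (fun u => (f u *: v u) 0 i).
Proof.
move=> sf sv; apply: (smooth_on_eq oU _ (smooth_onM oU sf sv)) => u _.
by rewrite mxE.
Qed.

Hypothesis metric_pos : forall u v, U u -> v != 0 -> 0 < metric X u v v.

(* Gram-Schmidt on the coordinate fields; the last clause keeps the next
   coordinate field independent of the vectors already constructed. *)
Lemma partial_frame_exists k : (k <= m)%N ->
  exists e : nat -> 'rV[R]_m -> 'rV[R]_m,
  [/\ forall a i, smooth_on U (fun u => e a u 0 i),
      forall u a b, U u -> (a < k)%N -> (b < k)%N ->
        metric X u (e a u) (e b u) = (a == b)%:R
    & forall u a (i : 'I_m), (a < k)%N -> (k <= i)%N -> e a u 0 i = 0].
Proof.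
elim: k => [_|k IH km].
  exists (fun _ _ => 0); split => // a i.
  apply: (smooth_on_eq oU _ (smooth_on_cst oU 0)) => u _.
  by rewrite mxE.
have [e [se oe ze]] := IH (ltnW km).
pose K := Ordinal km; pose d : 'rV[R]_m := delta_mx 0 K.
pose w u := d - \sum_(a < k) metric X u d (e a u) *: e a u.
have sd i : smooth_on U (fun u => d 0 i) by exact: smooth_on_cst.
have sw i : smooth_on U (fun u => w u 0 i).
  have s1 (a : 'I_k) : smooth_on U (fun u => (metric X u d (e a u) *: e a u) 0 i).
    by apply: smooth_on_rowZ (se a i); exact: (smooth_metric sd (se a)).
  have s2 : smooth_on U (fun u => \sum_(a < k) (metric X u d (e a u) *: e a u) 0 i).
    by apply: (smooth_on_sum oU) => a _; exact: s1.
  apply: (smooth_on_eq oU _ (smooth_onD oU (sd i) (smooth_onN oU s2))) => u _.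
  by rewrite /w [in RHS]mxE [in X in _ = _ + X]mxE summxE.
(* The earlier vectors have no component along [K], so w keeps the one of [d]; this makes w nonzero
   at every point and its normalization smooth on [U]. *)
have wK u : w u 0 K = 1.
  rewrite mxE [X in _ + X]mxE summxE big1 ?subr0 => [|a _].
    by rewrite mxE !eqxx.
  by rewrite mxE ze// mulr0.
have w0 u : w u != 0.
  by apply/eqP => w0; have := wK u; rewrite w0 mxE => /eqP; rewrite eq_sym oner_eq0.
have wi u (i : 'I_m) : (k < i)%N -> w u 0 i = 0.
  move=> ki; rewrite mxE [X in _ + X]mxE summxE big1 ?subr0 => [|a _].
    by rewrite mxE eqxx/=; case: eqP => // iK; rewrite iK ltnn in ki.
  by rewrite mxE ze ?mulr0// ltnW.
pose N u := metric X u (w u) (w u).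
have N0 u : U u -> 0 < N u by move=> Uu; exact: metric_pos.
have we u b : U u -> (b < k)%N -> metric X u (w u) (e b u) = 0.
  move=> Uu bk; rewrite metricE (bilinC _ _ (metric_mx_sym u)) /w.
  rewrite bilinDr -scaleN1r bilinZr bilin_sumr (bigD1 (Ordinal bk))//= bilinZr.
  rewrite -!metricE oe// eqxx mulr1 big1 ?addr0 => [|a ab].
    rewrite mulN1r [X in X - _](_ : _ = metric X u d (e b u)) ?subrr//.
    by rewrite !metricE (bilinC _ _ (metric_mx_sym u)).
  rewrite bilinZr -metricE oe//.
  have -> : (b == a :> nat) = false.
    by apply/negbTE; apply: contra ab => /eqP ba; apply/eqP/val_inj.
  by rewrite mulr0.
pose e' a u := if a == k then (Num.sqrt (N u))^-1 *: w u else e a u.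
exists e'; split.
- move=> a i; rewrite /e'; case: eqP => _; last exact: se.
  apply: smooth_on_rowZ (sw i).
  have sN : smooth_on U N := smooth_metric sw sw.
  apply: (smooth_onV oU (smooth_on_sqrt oU sN N0)) => u Uu.
  by rewrite gt_eqF// sqrtr_gt0 N0.
- move=> u a b Uu; rewrite /e' !ltnS => ak bk.
  have lt_k c : (c <= k)%N -> c <> k -> (c < k)%N.
    by move=> ck cnk; rewrite ltn_neqAle ck andbT; apply/eqP.
  case: eqP => [->|/(lt_k _ ak) ak']; case: eqP => [->|/(lt_k _ bk) bk'].
  + rewrite eqxx metricE bilinZl bilinZr -metricE -/(N u) mulrA -expr2 exprVn.
    by rewrite sqr_sqrtr ?ltW ?N0// mulVf// gt_eqF// N0.
  + by rewrite metricE bilinZl -metricE we// mulr0 gtn_eqF.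
  + rewrite metricE bilinZr (bilinC _ _ (metric_mx_sym u)) -metricE we// mulr0.
    by rewrite ltn_eqF.
  + exact: oe.
- move=> u a i; rewrite /e' ltnS => ak ki; case: eqP => [_|/eqP ank].
    by rewrite mxE wi ?mulr0.
  by apply: ze; [rewrite ltn_neqAle ank|exact: ltnW].
Qed.

(** The coordinate fields are defined on all of [U], hence so is the frame: one frame serves the
    whole chart. *)
Lemma orthonormal_frame_exists : exists e, orthonormal_frame X U e.
Proof.
have [e [se oe _]] := partial_frame_exists (leqnn m).
exists (fun a : 'I_m => e a); split.
  by move=> a; apply: (smooth_on_row oU) => i; exact: se.
by move=> u Uu a b; rewrite oe.
Qed.

End LocalFrame.

(** * The second fundamental form on constant fields *)

Section SecondForm.
Variables (R : realType) (m : nat) (U : set 'rV[R]_m).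
Variables (X nu : 'rV[R]_m -> 'rV[R]_m.+1).
Hypotheses (oU : open U) (sX : smooth_on U X).
Hypothesis Xnu : forall u v, U u -> dot ('D_v X u) (nu u) = 0.

Lemma derive_derive_row u v w c : U u ->
  'D_v (fun y => 'D_w X y) u 0 c =
  \sum_i \sum_j v 0 i * (w 0 j * pd i (pd j (fun y => X y 0 c)) u).
Proof.
move=> Uu.
have sdx j d : smooth_on U (pd j (fun y => X y 0 d)).
  exact (smooth_pd j (smooth_on_coord oU d sX)).
have DE d y : U y -> 'D_w X y 0 d = \sum_j w 0 j * pd j (fun y => X y 0 d) y.
  exact: derive_row_pd.
have sE d : smooth_on U (fun y => \sum_j w 0 j * pd j (fun y => X y 0 d) y).
  apply: (smooth_on_sum oU) => j _.
  exact: (smooth_onM oU (smooth_on_cst oU _) (sdx j d)).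
have sD : smooth_on U (fun y => 'D_w X y).
  apply: (smooth_on_row oU) => d.
  by apply: (smooth_on_eq oU _ (sE d)) => y Uy; rewrite DE.
rewrite (derive_row_pd oU v c sD Uu); apply: eq_bigr => i _.
rewrite (pd_eq_on oU i Uu (DE c)).
rewrite (partial_dot oU _ (fun j => smooth_on_cst oU (w 0 j)) (fun j => sdx j c) Uu).
rewrite mulr_sumr; apply: eq_bigr => j _.
by rewrite pd_cst mul0r add0r.
Qed.

(** The Levi-Civita term is pushed forward to a tangent vector, which [Xnu] kills; only the second
    derivatives of X remain. *)
Lemma second_form_cst u v w : U u ->
  dot (second_form X (cst v) (cst w) u) (nu u) = bilin (second_form_mx X nu u) v w.
Proof.
move=> Uu; rewrite bilinE.
have -> : dot (second_form X (cst v) (cst w) u) (nu u) =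
    \sum_c 'D_v (fun y => 'D_w X y) u 0 c * nu u 0 c
    - dot ('D_(levi_civita X (cst v) (cst w) u) X u) (nu u).
  by rewrite /dot -sumrB; apply: eq_bigr => c _; rewrite !mxE mulrBl.
rewrite Xnu// subr0.
under eq_bigr do rewrite derive_derive_row// mulr_suml.
rewrite exchange_big; apply: eq_bigr => i _.
under eq_bigr do rewrite mulr_suml.
rewrite exchange_big; apply: eq_bigr => j _.
rewrite mxE !mulr_suml; apply: eq_bigr => c _; ring.
Qed.

End SecondForm.

Theorem theorem1p2 (R : realType) (m : nat) (hm : (1 <= m)%N)
    (M : smooth_manifold R m) (x : M -> 'rV[R]_m.+1)
    (hx : immersion x) (hconvex : weakly_convex x)
    (H : M -> 'rV[R]_m.+1) (hH : mean_curvature_field x H)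
    (hbiharmonic : harmonic_field x H) :
  forall p : M, H p = 0.
Proof.
move=> p; have [c atlas_c cp] := atlas_cover p.
have [smooth_x inj_dx] := hx; have [nu [smooth_nu nu1 nu_perp] pc_ge0] := hconvex.
pose U := target c; pose X := x \o param c; pose n := nu \o param c.
have oU : open U by exact: target_open.
have sX : smooth_on U X := smooth_x c atlas_c.
have sn : smooth_on U n := smooth_nu c atlas_c.
have metric_pos u v : U u -> v != 0 -> 0 < metric X u v v.
  by move=> Uu; exact (metric_gt0 oU sX Uu (inj_dx c atlas_c u Uu)).
have [e frame_e] := orthonormal_frame_exists oU sX metric_pos.
have local_e : local_orthonormal_frame x c U e by split.
have Xn u v : U u -> dot ('D_v X u) (n u) = 0.
  by move=> Uu; exact: nu_perp c atlas_c u Uu v.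
have nn u : U u -> \sum_a n u 0 a * n u 0 a = 1 by move=> _; exact: nu1.
have xn u l : U u -> \sum_a pd l (fun w => X w 0 a) u * n u 0 a = 0.
  move=> Uu; rewrite -[RHS](Xn u (delta_mx 0 l) Uu); apply: eq_bigr => a _.
  by rewrite -(pd_coord l a sX Uu).
pose h := total_curvature X e n.
have B_ge0 u v : U u -> 0 <= bilin (second_form_mx X n u) v v.
  move=> Uu; apply: (@bilin_ge0_eigen _ _ _ (metric_mx X u)).
  - exact: (second_form_mx_sym n oU sX).
  - exact: metric_mx_sym.
  - by move=> w w0; rewrite -metricE; exact: metric_pos.
  - move=> k w w0 eigen_w; apply: (pc_ge0 c atlas_c u Uu); exists w => // w'.
    by rewrite metricE -eigen_w; exact: (second_form_cst oU sX Xn).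
have Hh u a : U u -> H (param c u) 0 a = m%:R^-1 * (h u * n u 0 a).
  move=> Uu; rewrite (hH c U e local_e u Uu) mxE; congr (_ * _).
  (* [pushforward] is the flat derivative of X, so the trace of the second fundamental form is by
     conversion the rough Laplacian of X. *)
  rewrite -[LHS]/(rough_laplacian X e X u 0 a) (rough_laplacianE oU sX frame_e)//.
  exact (laplacian_normal_part sX frame_e nn xn a Uu).
have sh : smooth_on U h by exact: smooth_total_curvature.
have shn a : smooth_on U (fun u => h u * n u 0 a).
  exact: (smooth_onM oU sh (smooth_on_coord oU a sn)).
have sm : smooth_on U (fun=> m%:R^-1 : R) by exact: smooth_on_cst.
(* The coordinate form of the Laplacian applies to smooth fields only; smoothness of [H] is read off
   the formula [Hh]. *)
have sH : smooth_on U (H \o param c).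
  apply: (smooth_on_row oU) => a.
  by apply: (smooth_on_eq oU _ (smooth_onM oU sm (shn a))) => u Uu /=; rewrite Hh.
(* The assumption m >= 1 enters here: the factor 1 / m can be cancelled. *)
have m0 : m%:R^-1 != 0 :> R by rewrite invr_eq0 pnatr_eq0 -lt0n.
have Lh u a : U u -> laplacian X e (fun w => h w * n w 0 a) u = 0.
  move=> Uu; apply: (mulfI m0); rewrite mulr0.
  have := congr1 (fun v : 'rV[R]_m.+1 => v 0 a) (hbiharmonic c U e local_e u Uu).
  rewrite /= (rough_laplacianE oU sX frame_e)// [RHS]mxE => <-.
  rewrite (laplacian_eq_on X e oU Uu (fun w Uw => Hh w a Uw)).
  rewrite (laplacianM X e oU sm (shn a) Uu) laplacian_cst mulr0 addr0.
  rewrite big1 ?mulr0 ?addr0// => i _; rewrite big1// => j _.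
  by rewrite pd_cst mul0r mulr0.
have Up : U (Defs.coord c p) by exists p.
rewrite -(coordK cp); apply/rowP => a; rewrite Hh// mxE.
have -> : h (Defs.coord c p) = 0.
  exact (total_curvature_eq0 oU sX frame_e sn nn xn B_ge0 Lh Up).
by rewrite mul0r mulr0.
Qed.
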